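(* For $\tau\in\mathbb{H}^2$ let $q=e^{2\pi i\tau}$ and $$W=\theta^2\begin{bmatrix}1\\ \frac14\end{bmatrix}(0,\tau)\Big/\theta^2\begin{bmatrix}1\\ \frac34\end{bmatrix}(0,\tau).$$ Then $W$ satisfies the Riccati equation $$q\frac{dW}{dq}=\frac1{(\sqrt2)^5}\,\frac{(q;q)_\infty^2(q^2;q^2)_\infty(q^4;q^4)_\infty^3}{(q^8;q^8)_\infty^2}\left(W^2-6W+1\right).$$
   Context: $\mathbb{H}^2$ is the upper half-plane. For $\epsilon,\epsilon'\in\mathbb{R}$, $\theta\begin{bmatrix}\epsilon\\ \epsilon'\end{bmatrix}(\zeta,\tau)=\sum_{n\in\mathbb{Z}}\exp\!\Big(2\pi i\Big[\tfrac12\big(n+\tfrac{\epsilon}{2}\big)^2\tau+\big(n+\tfrac{\epsilon}{2}\big)\big(\zeta+\tfrac{\epsilon'}{2}\big)\Big]\Big)$; $\theta^k$ is the $k$-th power. $(q^k;q^k)_\infty=\prod_{n\ge1}(1-q^{kn})$. The derivative $q\,d/dq$ is understood as $\frac{1}{2\pi i}\frac{d}{d\tau}$. *)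

(* Defs.v *)
From Stdlib Require Import Reals ClassicalEpsilon.
Open Scope R_scope.

Record Cpx := mkC { Re : R ; Im : R }.

Definition RtoC (x : R) : Cpx := mkC x 0.
Definition Ci : Cpx := mkC 0 1.
Definition Cadd (z w : Cpx) : Cpx := mkC (Re z + Re w) (Im z + Im w).
Definition Copp (z : Cpx) : Cpx := mkC (- Re z) (- Im z).
Definition Csub (z w : Cpx) : Cpx := Cadd z (Copp w).
Definition Cmul (z w : Cpx) : Cpx :=
  mkC (Re z * Re w - Im z * Im w) (Re z * Im w + Im z * Re w).
Definition Cnorm2 (z : Cpx) : R := Re z * Re z + Im z * Im z.
Definition Cinv (z : Cpx) : Cpx := mkC (Re z / Cnorm2 z) (- Im z / Cnorm2 z).
Definition Cdiv (z w : Cpx) : Cpx := Cmul z (Cinv w).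
Definition Cabs (z : Cpx) : R := sqrt (Cnorm2 z).
Definition Cexp (z : Cpx) : Cpx := mkC (exp (Re z) * cos (Im z)) (exp (Re z) * sin (Im z)).
Fixpoint Cpow (z : Cpx) (n : nat) : Cpx :=
  match n with O => RtoC 1 | S m => Cmul z (Cpow z m) end.

Definition Ccv (u : nat -> Cpx) (l : Cpx) : Prop :=
  forall eps : R, eps > 0 -> exists N : nat, forall n : nat, (n >= N)%nat ->
    Cabs (Csub (u n) l) < eps.

(* The value of a convergent sequence (chosen by classical description;
   arbitrary if the sequence does not converge). *)
Definition Clim (u : nat -> Cpx) : Cpx :=
  epsilon (inhabits (RtoC 0)) (fun l => Ccv u l).

Fixpoint Zpartial (f : Z -> Cpx) (N : nat) : Cpx :=
  match N with
  | O => f 0%Z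
  | S M => Cadd (Zpartial f M)
             (Cadd (f (Z.of_nat (S M))) (f (- Z.of_nat (S M))%Z))
  end.
Definition Zsum (f : Z -> Cpx) : Cpx := Clim (Zpartial f).

Definition theta (e e' : R) (zeta tau : Cpx) : Cpx :=
  Zsum (fun n : Z =>
    let a := RtoC (IZR n + e / 2) in
    Cexp (Cmul (Cmul (RtoC 2) (Cmul (RtoC PI) Ci))
      (Cadd (Cmul (RtoC (1/2)) (Cmul (Cmul a a) tau))
            (Cmul a (Cadd zeta (RtoC (e' / 2))))))).

Definition qof (tau : Cpx) : Cpx := Cexp (Cmul (Cmul (RtoC 2) (Cmul (RtoC PI) Ci)) tau).

Fixpoint qpartial (x : Cpx) (N : nat) : Cpx :=
  match N with
  | O => RtoC 1
  | S M => Cmul (qpartial x M) (Csub (RtoC 1) (Cpow x (S M)))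
  end.
Definition qpoch_inf (x : Cpx) : Cpx := Clim (qpartial x).

Definition Cderiv_lim (f : Cpx -> Cpx) (z l : Cpx) : Prop :=
  forall eps : R, eps > 0 -> exists delta : R, delta > 0 /\
    forall h : Cpx, h <> RtoC 0 -> Cabs h < delta ->
      Cabs (Csub (Cdiv (Csub (f (Cadd z h)) (f z)) h) l) < eps.

Definition Wfun (tau : Cpx) : Cpx :=
  let t1 := theta 1 (1/4) (RtoC 0) tau in
  let t3 := theta 1 (3/4) (RtoC 0) tau in
  Cdiv (Cmul t1 t1) (Cmul t3 t3).

(* Main.v *)
(* Put q = r^8 and zeta = exp(pi i / 8). The two theta constants are
   t1 = sum zeta^a r^(a^2) and t3 = sum zeta^(3a) r^(a^2) over odd integers a, so the
   Riccati equation is a relation between t1, t3 and the Wronskian of t1 and t3 for q d/dq.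
   Substituting a = u + v, b = u - v in products of two such series (exactly one of
   u, v is then odd) factors
     - the Wronskian, into two series sum +-(2j+1) x^(j(j+1)/2), that is, into cubes of
       Euler products by Jacobi's identity;
     - t1^2 - t3^2 and t1 t3, so that (t1^2 - t3^2)^2 - 4 t1^2 t3^2 = t1^4 - 6 t1^2 t3^2 + t3^4
       becomes a product of theta constants.
   Each single series is an infinite product by the Jacobi triple product, obtained as the
   limit (Tannery) of its finite form with q-binomial coefficients. Comparing the products
   gives the equation. *)
From HB Require Import structures.
From Stdlib Require Import Reals.
From mathcomp Require Import all_boot all_order all_algebra.
From mathcomp Require Import boolp Rstruct.
Set Implicit Arguments.
Unset Strict Implicit.
Unset Printing Implicit Defensive.
Import Order.TTheory GRing.Theory Num.Theory.
Require Import Defs.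
From mathcomp Require Import ring lra zify.
Local Open Scope ring_scope.

(** * The field of complex numbers *)

(** The decisive property of zeta is that i = zeta^4 satisfies 1/i = -i: reflection and sign change
    of the parameter then force an even-index sum of odd weight and an odd-index sum of weight 0 to
    vanish at i, so that in the Wronskian and in t1 t3 only one of the two products left by the
    substitution survives. Constants: q d/dq is (1/8) r d/dr, zeta^2 + zeta^-2 = sqrt 2, and 1/(sqrt
    2)^5 = (sqrt 2)/8. With Pk the Euler product at q^k, both sides of the equation, multiplied by
    t3^4, equal 8 (sqrt 2) r^12 P1^2 P2^3 P8^4 / P4. Jacobi's identity is not obtained by
    differentiating the triple product: the finite form is proved for any solution of a three-term
    recurrence, and Jacobi's identity is the case where the recurrence has a double root. The
    product t1 t3 is evaluated as a whole, since the two middle coefficients are opposite and the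
    factors combine; its value also shows that t3 is not zero. Rearranging double series calls for
    sums over arbitrary index types, independent of any order; the symmetric partial sums behind
    [theta] are linked to them by [Zsum_eq]. *)

HB.instance Definition _ := gen_eqMixin Cpx.
HB.instance Definition _ := gen_choiceMixin Cpx.

Lemma Cpx_eq (z w : Cpx) : Re z = Re w -> Im z = Im w -> z = w.
Proof. by case: z => a b; case: w => c d /= -> ->. Qed.

Lemma IZR0E : IZR Z0 = 0 :> R. Proof. by []. Qed.
Lemma IZR1E : IZR (Zpos xH) = 1 :> R. Proof. by []. Qed.
Definition RE := (RplusE, RmultE, RoppE, RminusE, IZR0E, IZR1E).
Lemma CaddA : associative Cadd.
Proof. move=> x y z; apply: Cpx_eq => /=; rewrite !RE; ring. Qed.
Lemma CaddC : commutative Cadd.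
Proof. move=> x y; apply: Cpx_eq => /=; rewrite !RE; ring. Qed.
Lemma Cadd0 : left_id (RtoC 0) Cadd.
Proof. move=> x; apply: Cpx_eq => /=; rewrite !RE; ring. Qed.
Lemma CaddN : left_inverse (RtoC 0) Copp Cadd.
Proof. by move=> x; apply: Cpx_eq => /=; rewrite !RE; ring. Qed.
HB.instance Definition _ := GRing.isZmodule.Build Cpx CaddA CaddC Cadd0 CaddN.

Lemma CmulA : associative Cmul.
Proof. move=> x y z; apply: Cpx_eq => /=; rewrite !RE; ring. Qed.
Lemma CmulC : commutative Cmul.
Proof. move=> x y; apply: Cpx_eq => /=; rewrite !RE; ring. Qed.
Lemma Cmul1 : left_id (RtoC 1) Cmul.
Proof. move=> x; apply: Cpx_eq => /=; rewrite !RE; ring. Qed.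
Lemma CmulDl : left_distributive Cmul Cadd.
Proof. move=> x y z; apply: Cpx_eq => /=; rewrite !RE; ring. Qed.
Lemma C1neq0 : RtoC 1 != 0.
Proof. by apply/eqP => -[] /eqP; rewrite oner_eq0. Qed.
HB.instance Definition _ :=
  GRing.Zmodule_isComNzRing.Build Cpx CmulA CmulC Cmul1 CmulDl C1neq0.

Lemma Cnorm2_eq0 (z : Cpx) : (Cnorm2 z == 0) = (z == 0).
Proof.
apply/eqP/eqP => [|->]; last by rewrite /Cnorm2 /= !RE; ring.
rewrite /Cnorm2 !RE -!expr2 => /eqP; rewrite paddr_eq0 ?sqr_ge0 // !sqrf_eq0.
by case/andP => /eqP a /eqP b; apply: Cpx_eq.
Qed.
Lemma CmulV (z : Cpx) : z != 0 -> Cmul (Cinv z) z = 1.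
Proof.
rewrite -Cnorm2_eq0 => nz; apply: Cpx_eq => /=; rewrite !RdivE !RE;
  rewrite /Cnorm2 !RE in nz *; field; exact: nz.
Qed.
Lemma Cinv0 : Cinv 0 = 0.
Proof. by apply: Cpx_eq; rewrite /= !RdivE ?RE ?oppr0 mul0r. Qed.
HB.instance Definition _ := GRing.ComNzRing_isField.Build Cpx CmulV Cinv0.

Lemma Cabs_ge0 z : 0 <= Cabs z.
Proof. by apply/RleP; apply: sqrt_pos. Qed.
Lemma Cnorm2_ge0 z : 0 <= Cnorm2 z.
Proof. by rewrite /Cnorm2 !RE -!expr2 addr_ge0 ?sqr_ge0. Qed.
Lemma Cabs_sqr z : Cabs z ^+ 2 = Cnorm2 z.
Proof. by rewrite expr2; apply: sqrt_sqrt; apply/RleP/Cnorm2_ge0. Qed.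
Lemma CabsM z w : Cabs (z * w) = Cabs z * Cabs w.
Proof.
apply/eqP; rewrite -(@eqrXn2 _ 2) ?mulr_ge0 ?Cabs_ge0 // exprMn !Cabs_sqr.
by apply/eqP; rewrite /Cnorm2 /= !RE; ring.
Qed.
Lemma Re_le_Cabs z : Re z <= Cabs z.
Proof.
apply: le_trans (ler_norm _) _; rewrite -(@ler_pXn2r _ 2) ?nnegrE ?Cabs_ge0 //.
by rewrite Cabs_sqr -normrX ger0_norm ?sqr_ge0 // /Cnorm2 !RE -!expr2 lerDl sqr_ge0.
Qed.
Lemma CabsD z w : Cabs (z + w) <= Cabs z + Cabs w.
Proof.
rewrite -(@ler_pXn2r _ 2) ?nnegrE ?addr_ge0 ?Cabs_ge0 // sqrrD !Cabs_sqr.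
have := Re_le_Cabs (z * mkC (Re w) (- Im w)); rewrite CabsM /=.
have -> : Cabs (mkC (Re w) (- Im w)) = Cabs w.
  by congr sqrt; rewrite /Cnorm2 /= !RE; ring.
rewrite /Cnorm2 /= !RE; lra.
Qed.
Lemma Cabs0_eq0 z : Cabs z = 0 -> z = 0.
Proof. by move=> h; apply/eqP; rewrite -Cnorm2_eq0 -Cabs_sqr h expr0n. Qed.
Lemma CabsN z : Cabs (- z) = Cabs z.
Proof. by congr sqrt; rewrite /Cnorm2 /= !RE; ring. Qed.
Lemma CabsMn z n : Cabs (z *+ n) = Cabs z *+ n.
Proof.
have C0 : Cabs 0 = 0.
  by apply/eqP; rewrite -sqrf_eq0 Cabs_sqr /Cnorm2 /= !RE !mulr0 addr0.
have C1 : Cabs 1 = 1.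
  apply/eqP; rewrite -(@eqrXn2 _ 2) ?Cabs_ge0 // Cabs_sqr.
  by apply/eqP; rewrite /Cnorm2 /= !RE; ring.
rewrite -mulr_natl CabsM -[RHS]mulr_natl; congr (_ * _).
have -> : n%:R = RtoC n%:R :> Cpx.
  elim: n => [//|n IH]; rewrite -addn1 !natrD IH.
  by apply: Cpx_eq => /=; rewrite !RE ?addr0.
apply/eqP; rewrite -(@eqrXn2 _ 2) ?Cabs_ge0 ?ler0n // Cabs_sqr.
by apply/eqP; rewrite /Cnorm2 /= !RE; ring.
Qed.
HB.instance Definition _ :=
  @Num.Zmodule_isNormed.Build R Cpx Cabs CabsD Cabs0_eq0 CabsMn CabsN.

(** A normed Z-module knows no product, so multiplicativity of the modulus and its consequences are
    supplied by hand. *)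
Lemma CnormM (z w : Cpx) : `|z * w| = `|z| * `|w|. Proof. exact: CabsM. Qed.
Lemma Cnorm1 : `|1 : Cpx| = 1.
Proof.
apply/eqP; rewrite -(@eqrXn2 _ 2) ?normr_ge0 // expr2 -CnormM mulr1.
have n0 : `|1 : Cpx| != 0 by rewrite normr_eq0 oner_neq0.
by apply/eqP/(mulfI n0); rewrite -CnormM !mulr1 expr1n mulr1.
Qed.
Lemma CnormX (z : Cpx) n : `|z ^+ n| = `|z| ^+ n.
Proof. by elim: n => [|n IH]; rewrite ?expr0 ?Cnorm1 // !exprS CnormM IH. Qed.
Lemma CnormV (z : Cpx) : `|z^-1| = `|z|^-1.
Proof.
have [->|z0] := eqVneq z 0; first by rewrite invr0 normr0 invr0.
have n0 : `|z| != 0 by rewrite normr_eq0.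
by apply: (mulfI n0); rewrite -CnormM !divff // Cnorm1.
Qed.
Lemma Cnorm_RtoC (x : R) : `|RtoC x| = `|x|.
Proof.
apply/eqP; rewrite -(@eqrXn2 _ 2) ?normr_ge0 // Cabs_sqr -normrX ger0_norm ?sqr_ge0 //.
by apply/eqP; rewrite /Cnorm2 /= !RE; ring.
Qed.
Lemma Cnorm_Re (z : Cpx) : `|Re z| <= `|z|.
Proof.
rewrite -(@ler_pXn2r _ 2) ?nnegrE ?normr_ge0 // Cabs_sqr.
by rewrite -normrX ger0_norm ?sqr_ge0 // /Cnorm2 !RE -!expr2 lerDl sqr_ge0.
Qed.
Lemma Cnorm_Im (z : Cpx) : `|Im z| <= `|z|.
Proof.
rewrite -(@ler_pXn2r _ 2) ?nnegrE ?normr_ge0 // Cabs_sqr.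
by rewrite -normrX ger0_norm ?sqr_ge0 // /Cnorm2 !RE -!expr2 lerDr sqr_ge0.
Qed.
Lemma Cnorm_le (z : Cpx) : `|z| <= `|Re z| + `|Im z|.
Proof.
have -> : z = RtoC (Re z) + Ci * RtoC (Im z).
  by apply: Cpx_eq => /=; rewrite !RE; ring.
apply: le_trans (ler_normD _ _) _; rewrite CnormM !Cnorm_RtoC /= !RE.
have -> : `|Ci| = 1.
  apply/eqP; rewrite -(@eqrXn2 _ 2) ?normr_ge0 // Cabs_sqr.
  by apply/eqP; rewrite /Cnorm2 /= !RE; ring.
by rewrite !(mul0r, mul1r, mulr0, addr0, add0r, subr0).
Qed.

(** * Unconditional summation *)

(** Convergence along the net of finite subsets, encoded as duplicate-free sequences; no enumeration
    of the index type enters, which makes reindexing immediate. *)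
Definition hasSum (V : normedZmodType R) (I : choiceType) (f : I -> V) (l : V) :=
  forall e : R, 0 < e -> exists s : seq I, forall t, uniq t ->
    {subset s <= t} -> `|\sum_(i <- t) f i - l| < e.

Definition asummable (V : normedZmodType R) (I : choiceType) (f : I -> V) :=
  exists M : R, forall s : seq I, uniq s -> \sum_(i <- s) `|f i| <= M.

Lemma hasSum_unique (V : normedZmodType R) (I : choiceType) (f : I -> V) l m :
  hasSum f l -> hasSum f m -> l = m.
Proof.
move=> hl hm; apply/eqP; rewrite -subr_eq0 -normr_le0 leNgt; apply/negP => e0.
have e2 : 0 < `|l - m| / 2 by lra.
have [s hs] := hl _ e2; have [t ht] := hm _ e2.
pose u := undup (s ++ t).
have := hs u (undup_uniq _); have := ht u (undup_uniq _).
have st : {subset s <= u} by move=> i si; rewrite mem_undup mem_cat si.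
have tt : {subset t <= u} by move=> i si; rewrite mem_undup mem_cat si orbT.
move=> /(_ tt) h1 /(_ st) h2.
have : `|l - m| <= `|\sum_(i <- u) f i - l| + `|\sum_(i <- u) f i - m|.
  rewrite (distrC _ l); apply: le_trans (ler_normD _ _).
  by rewrite addrA subrK.
lra.
Qed.

Lemma ler_sum_subset (I : choiceType) (f : I -> R) (s t : seq I) :
  (forall i, 0 <= f i) -> uniq s -> uniq t -> {subset s <= t} ->
  \sum_(i <- s) f i <= \sum_(i <- t) f i.
Proof.
move=> f0 us ut st; rewrite [leRHS](bigID (mem s)) /=.
have -> : \sum_(i <- t | i \in s) f i = \sum_(i <- s) f i.
  rewrite -big_filter; apply: perm_big; apply: uniq_perm => //; first exact: filter_uniq.
  move=> i; rewrite mem_filter; apply/andP/idP => [[]//|si]; split => //.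
  exact: st.
by rewrite lerDl sumr_ge0.
Qed.

(** The sum is the supremum of the finite sums; by monotonicity one nearly optimal finite set
    controls all larger ones. *)
Lemma hasSum_ge0 (I : choiceType) (f : I -> R) :
  (forall i, 0 <= f i) -> asummable f -> exists l, hasSum f l.
Proof.
move=> f0 [M hM].
pose E x := exists2 s : seq I, uniq s & x = \sum_(i <- s) f i.
have [l [ub lub]] : {l | is_lub E l}.
  apply: completeness.
    exists M => x [s us ->]; apply/RleP; apply: le_trans (hM _ us).
    by apply: ler_sum => i _; rewrite ger0_norm.
  by exists 0, [::]; rewrite ?big_nil.
exists l => e e0.
have [s us hs] : exists2 s : seq I, uniq s & l - e < \sum_(i <- s) f i.
  apply: contrapT => hn.
  have : l <= l - e.
    apply/RleP/lub => x [s us ->]; apply/RleP; rewrite leNgt; apply/negP => h.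
    by apply: hn; exists s.
  lra.
exists s => t ut st.
have h1 : \sum_(i <- t) f i <= l by apply/RleP/ub; exists t.
have h2 := ler_sum_subset f0 us ut st.
by rewrite ltr_norml; apply/andP; split; lra.
Qed.

Lemma hasSumD (V : normedZmodType R) (I : choiceType) (f g : I -> V) l m :
  hasSum f l -> hasSum g m -> hasSum (fun i => f i + g i) (l + m).
Proof.
move=> hl hm e e0; have e2 : 0 < e / 2 by lra.
have [s hs] := hl _ e2; have [t ht] := hm _ e2.
exists (s ++ t) => u uu stu.
have h1 : `|\sum_(i <- u) g i - m| < e / 2.
  by apply: ht => // i si; apply: stu; rewrite mem_cat si orbT.
have h2 : `|\sum_(i <- u) f i - l| < e / 2.
  by apply: hs => // i si; apply: stu; rewrite mem_cat si.
rewrite big_split /= opprD addrACA.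
apply: le_lt_trans (ler_normD _ _) _; lra.
Qed.

Lemma hasSumN (V : normedZmodType R) (I : choiceType) (f : I -> V) l :
  hasSum f l -> hasSum (fun i => - f i) (- l).
Proof.
move=> hl e e0; have [s hs] := hl _ e0; exists s => t ut st.
by rewrite sumrN -opprD normrN; apply: hs.
Qed.

Lemma hasSumZ (I : choiceType) (f : I -> Cpx) l c :
  hasSum f l -> hasSum (fun i => c * f i) (c * l).
Proof.
move=> hl e e0; have c0 : 0 < `|c| + 1 by have := normr_ge0 c; lra.
have [s hs] := hl _ (divr_gt0 e0 c0); exists s => t ut st.
rewrite -mulr_sumr -mulrBr CnormM.
have := hs _ ut st; rewrite ltr_pdivlMr // mulrC => h.
apply: le_lt_trans h; apply: ler_wpM2r => //; lra.
Qed.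

Lemma asummable_le (V W : normedZmodType R) (I : choiceType) (f : I -> V) (g : I -> W) :
  (forall i, `|f i| <= `|g i|) -> asummable g -> asummable f.
Proof.
move=> fg [M hM]; exists M => s us; apply: le_trans (hM _ us).
exact: ler_sum.
Qed.

Lemma asummableD (V : normedZmodType R) (I : choiceType) (f g : I -> V) :
  asummable f -> asummable g -> asummable (fun i => f i + g i).
Proof.
move=> [M hM] [N hN]; exists (M + N) => s us.
apply: le_trans (lerD (hM _ us) (hN _ us)).
by rewrite -big_split; apply: ler_sum => i _; apply: ler_normD.
Qed.

Lemma asummableZ (I : choiceType) (f : I -> Cpx) c :
  asummable f -> asummable (fun i => c * f i).
Proof.
move=> [M hM]; exists (`|c| * M) => s us.
under eq_bigr do rewrite CnormM.
by rewrite -mulr_sumr ler_wpM2l ?hM.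
Qed.

Lemma asummable_real_hasSum (I : choiceType) (f : I -> R) :
  asummable f -> exists l, hasSum f l.
Proof.
move=> af.
have ann : asummable (fun i => `|f i|).
  by apply: asummable_le af => i; rewrite normr_id.
(* The family is the difference of the nonnegative families [|f| + f] and [|f|]. *)
have [|l hl] := @hasSum_ge0 _ (fun i => `|f i| + f i) _ (asummableD ann af).
  by move=> i; have := ler_norm (- f i); rewrite normrN; lra.
have [m hm] := @hasSum_ge0 _ (fun i => `|f i|) (fun i => normr_ge0 _) ann.
exists (l - m); have := hasSumD hl (hasSumN hm).
by congr hasSum; apply: funext => i; ring.
Qed.

Lemma asummable_hasSum (I : choiceType) (f : I -> Cpx) :
  asummable f -> exists l, hasSum f l.
Proof.
move=> af.
have [|a ha] := @asummable_real_hasSum _ (fun i => Re (f i)).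
  by apply: asummable_le af => i; apply: Cnorm_Re.
have [|b hb] := @asummable_real_hasSum _ (fun i => Im (f i)).
  by apply: asummable_le af => i; apply: Cnorm_Im.
have ReD s : Re (\sum_(i <- s) f i) = \sum_(i <- s) Re (f i).
  by elim: s => [|i s IH]; rewrite ?big_nil // !big_cons /= RplusE IH.
have ImD s : Im (\sum_(i <- s) f i) = \sum_(i <- s) Im (f i).
  by elim: s => [|i s IH]; rewrite ?big_nil // !big_cons /= RplusE IH.
exists (mkC a b) => e e0; have e2 : 0 < e / 2 by lra.
have [s hs] := ha _ e2; have [t ht] := hb _ e2.
exists (s ++ t) => u uu stu.
apply: le_lt_trans (Cnorm_le _) _; rewrite /= !RE ReD ImD.
have h1 : `|\sum_(i <- u) Re (f i) - a| < e / 2.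
  by apply: hs => // i si; apply: stu; rewrite mem_cat si.
have h2 : `|\sum_(i <- u) Im (f i) - b| < e / 2.
  by apply: ht => // i si; apply: stu; rewrite mem_cat si orbT.
by lra.
Qed.

Definition tsum (I : choiceType) (f : I -> Cpx) : Cpx :=
  ClassicalEpsilon.epsilon (inhabits 0) (hasSum f).

Lemma tsumP (I : choiceType) (f : I -> Cpx) : asummable f -> hasSum f (tsum f).
Proof. by move=> /asummable_hasSum; apply: ClassicalEpsilon.epsilon_spec. Qed.

Lemma tsum_eq (I : choiceType) (f : I -> Cpx) l : hasSum f l -> tsum f = l.
Proof.
move=> h; apply: (hasSum_unique _ h).
by apply: (ClassicalEpsilon.epsilon_spec (inhabits 0) (hasSum f)); exists l.
Qed.

Lemma tsumD (I : choiceType) (f g : I -> Cpx) : asummable f -> asummable g ->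
  tsum (fun i => f i + g i) = tsum f + tsum g.
Proof. by move=> hf hg; apply: tsum_eq; apply: hasSumD; apply: tsumP. Qed.

Lemma tsumZ (I : choiceType) (f : I -> Cpx) c : asummable f ->
  tsum (fun i => c * f i) = c * tsum f.
Proof. by move=> hf; apply: tsum_eq; apply: hasSumZ; apply: tsumP. Qed.

Lemma hasSum_reindex (V : normedZmodType R) (I J : choiceType) (h : J -> I) (k : I -> J)
    (f : I -> V) l : cancel h k -> cancel k h ->
  hasSum f l -> hasSum (fun j => f (h j)) l.
Proof.
move=> hk kh hl e e0; have [s hs] := hl _ e0.
exists (map k s) => t ut st; rewrite -(big_map h predT f); apply: hs.
  by rewrite map_inj_uniq //; apply: can_inj hk.
move=> i si; apply/mapP; exists (k i); rewrite ?kh //.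
by apply: st; apply: map_f.
Qed.

Lemma tsum_reindex (I J : choiceType) (h : J -> I) (k : I -> J) (f : I -> Cpx) :
  cancel h k -> cancel k h -> tsum (fun j => f (h j)) = tsum f.
Proof.
move=> hk kh; have [[l hl]|nl] := pselect (exists l, hasSum f l).
  by rewrite (tsum_eq hl); apply: tsum_eq; apply: hasSum_reindex hl.
(* When no sum exists both predicates are empty, hence equal, and the choice operator returns the
   same default for both. *)
congr (ClassicalEpsilon.epsilon _ _); apply: funext => l; apply: propext; split => hl.
  case: nl; exists l; have := hasSum_reindex kh hk hl.
  by congr hasSum; apply: funext => i /=; rewrite kh.
by case: nl; exists l.
Qed.

Lemma asummable_inj (V : normedZmodType R) (I J : choiceType) (h : J -> I) (f : I -> V) :
  injective h -> asummable f -> asummable (fun j => f (h j)).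
Proof.
move=> ih [M hM]; exists M => s us; rewrite -(big_map h predT (fun i => `|f i|)).
by apply: hM; rewrite map_inj_uniq.
Qed.

(** The value group is quantified inside the conclusion because the same splitting serves a family
    and its real norms. *)
Lemma perm_sum_split (J K : choiceType) (t : seq (J + K)) : uniq t ->
  let t1 := pmap (fun x => if x is inl j then Some j else None) t in
  let t2 := pmap (fun x => if x is inr k then Some k else None) t in
  [/\ uniq t1, uniq t2 & forall (V : nmodType) (f : J + K -> V),
    \sum_(x <- t) f x = \sum_(j <- t1) f (inl j) + \sum_(k <- t2) f (inr k)].
Proof.
move=> ut t1 t2; split.
- by apply: (@pmap_uniq _ _ _ inl) => //; case.
- by apply: (@pmap_uniq _ _ _ inr) => //; case.
move=> V f; rewrite /t1 /t2 {ut t1 t2}.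
elim: t => [|[j|k] t IH] /=; rewrite ?big_nil ?addr0 // !big_cons IH.
  by rewrite addrA.
by rewrite addrCA.
Qed.

Lemma hasSum_sumtype (V : normedZmodType R) (J K : choiceType) (f : J + K -> V) a b :
  hasSum (fun j => f (inl j)) a -> hasSum (fun k => f (inr k)) b -> hasSum f (a + b).
Proof.
move=> ha hb e e0; have e2 : 0 < e / 2 by lra.
have [s hs] := ha _ e2; have [t ht] := hb _ e2.
exists (map inl s ++ map inr t) => u uu stu.
have [u1 u2 ->] := perm_sum_split uu.
have h1 := hs _ u1; have h2 := ht _ u2.
rewrite opprD addrACA; apply: le_lt_trans (ler_normD _ _) _.
have {}h1 := h1 _; have {}h2 := h2 _.
apply: (@lt_le_trans _ _ (e / 2 + e / 2)); last by lra.
apply: ltrD.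
  apply: h1 => j js; rewrite mem_pmap; apply/mapP; exists (inl j) => //.
  by apply: stu; rewrite mem_cat map_f.
apply: h2 => j js; rewrite mem_pmap; apply/mapP; exists (inr j) => //.
by apply: stu; rewrite mem_cat map_f ?orbT.
Qed.

Lemma asummable_sumtype (V : normedZmodType R) (J K : choiceType) (f : J + K -> V) :
  asummable (fun j => f (inl j)) -> asummable (fun k => f (inr k)) -> asummable f.
Proof.
move=> [M hM] [N hN]; exists (M + N) => s us.
have [u1 u2 ->] := perm_sum_split us.
exact: lerD (hM _ u1) (hN _ u2).
Qed.

Lemma tsum_sumtype (J K I : choiceType) (h : J + K -> I) (k : I -> J + K) (f : I -> Cpx) :
  cancel h k -> cancel k h -> asummable f ->
  tsum f = tsum (fun j => f (h (inl j))) + tsum (fun j => f (h (inr j))).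
Proof.
move=> hk kh af; rewrite -(tsum_reindex _ hk kh); apply: tsum_eq.
have ih := can_inj hk.
apply: hasSum_sumtype; apply: tsumP.
  by apply: (@asummable_inj _ _ _ (fun j => h (inl j))) => // a b /ih [].
by apply: (@asummable_inj _ _ _ (fun j => h (inr j))) => // a b /ih [].
Qed.

Lemma sub_allpairs (I J : choiceType) (t : seq (I * J)) :
  {subset t <= allpairs pair (undup (unzip1 t)) (undup (unzip2 t))}.
Proof.
move=> [i j] ij; apply/allpairsP; exists (i, j); rewrite !mem_undup; split => //.
  exact: (map_f fst ij).
exact: (map_f snd ij).
Qed.

Lemma sum_allpairs_mul (I J : choiceType) (A : pzSemiRingType) (f : I -> A) (g : J -> A) s t :
  \sum_(x <- allpairs pair s t) f x.1 * g x.2 = (\sum_(i <- s) f i) * (\sum_(j <- t) g j).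
Proof.
rewrite big_allpairs mulr_suml; apply: eq_bigr => i _.
by rewrite mulr_sumr.
Qed.

Lemma asummable_mul (I J : choiceType) (f : I -> Cpx) (g : J -> Cpx) :
  asummable f -> asummable g -> asummable (fun x : I * J => f x.1 * g x.2).
Proof.
move=> [M hM] [N hN]; exists (M * N) => t ut.
under eq_bigr do rewrite CnormM.
have [u1 u2] := (undup_uniq (unzip1 t), undup_uniq (unzip2 t)).
apply: (@le_trans _ _ (\sum_(x <- allpairs pair (undup (unzip1 t)) (undup (unzip2 t)))
    `|f x.1| * `|g x.2|)).
  apply: ler_sum_subset => //; last exact: sub_allpairs.
  - by move=> i; rewrite mulr_ge0.
  - by apply: allpairs_uniq => // -[a b] [c d].
rewrite (sum_allpairs_mul (fun i => `|f i|) (fun i => `|g i|)).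
by apply: ler_pM; rewrite ?sumr_ge0 ?hM ?hN.
Qed.

Lemma asummable_tail (V : normedZmodType R) (I : choiceType) (f : I -> V) :
  asummable f -> forall e : R, 0 < e -> exists2 s : seq I, uniq s &
    forall t, uniq t -> {in t, forall i, i \notin s} -> \sum_(i <- t) `|f i| < e.
Proof.
move=> af e e0; have [|l hl] := @hasSum_ge0 _ (fun i => `|f i|) (fun i => normr_ge0 _).
  by apply: asummable_le af => i; rewrite normr_id.
have e2 : 0 < e / 2 by lra.
have [s hs] := hl _ e2; exists (undup s); first exact: undup_uniq.
move=> t ut ts.
have h1 : `|\sum_(i <- undup s) `|f i| - l| < e / 2.
  by apply: hs; rewrite ?undup_uniq // => i; rewrite mem_undup.
have h2 : `|\sum_(i <- undup s ++ t) `|f i| - l| < e / 2.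
  apply: hs => [|i si]; last by rewrite mem_cat mem_undup si.
  rewrite cat_uniq undup_uniq ut andbT /=; apply/hasPn => i it.
  exact: ts.
move: h1 h2; rewrite big_cat /= !ltr_norml => /andP[] ? ? /andP[]; lra.
Qed.

Lemma tsum_norm_le (I : choiceType) (f : I -> Cpx) M :
  (forall s, uniq s -> \sum_(i <- s) `|f i| <= M) -> `|tsum f| <= M.
Proof.
move=> hM; have af : asummable f by exists M.
apply/ler_addgt0Pr => e e0; have [s hs] := tsumP af e0.
have h : `|\sum_(i <- undup s) f i - tsum f| < e.
  by apply: hs; rewrite ?undup_uniq // => i; rewrite mem_undup.
have h1 := le_trans (ler_norm_sum (undup s) f predT) (hM _ (undup_uniq s)).
have h2 : `|tsum f| <= `|\sum_(i <- undup s) f i| + `|\sum_(i <- undup s) f i - tsum f|.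
  by rewrite -[X in _ + X]normrN; apply: le_trans (ler_normD _ _); rewrite opprB addrC subrK.
lra.
Qed.

(** The family of products has some sum [c]; comparing [c] with [a * b] on one finite rectangle,
    large enough for all three sums, identifies them. *)
Lemma hasSum_mul (I J : choiceType) (f : I -> Cpx) (g : J -> Cpx) a b :
  asummable f -> asummable g -> hasSum f a -> hasSum g b ->
  hasSum (fun x : I * J => f x.1 * g x.2) (a * b).
Proof.
move=> af ag hf hg.
have [c hc] := asummable_hasSum (asummable_mul af ag).
suff -> : a * b = c by [].
apply/eqP; rewrite -subr_eq0 -normr_le0; apply/ler_addgt0Pr => e e0; rewrite add0r.
(* The bound by 1 turns d^2 into d; the four errors d, d, |a| d and d |b| then add up to at most
   [e]. *)
pose d := Num.min 1 (e / (`|a| + `|b| + 2)).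
have D0 : 0 < `|a| + `|b| + 2 by have := normr_ge0 a; have := normr_ge0 b; lra.
have d0 : 0 < d by rewrite lt_min ltr01 divr_gt0.
have d1 : d <= 1 by rewrite ge_min lexx.
have de : d * (`|a| + `|b| + 2) <= e.
  by rewrite -ler_pdivlMr // ge_min lexx orbT.
have [s hs] := hf _ d0; have [t ht] := hg _ d0; have [u hu] := hc _ d0.
pose s' := undup (s ++ unzip1 u); pose t' := undup (t ++ unzip2 u).
have h1 : `|\sum_(i <- s') f i - a| < d.
  by apply: hs; rewrite ?undup_uniq // => i si; rewrite mem_undup mem_cat si.
have h2 : `|\sum_(i <- t') g i - b| < d.
  by apply: ht; rewrite ?undup_uniq // => i si; rewrite mem_undup mem_cat si.
have h3 : `|\sum_(x <- allpairs pair s' t') f x.1 * g x.2 - c| < d.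
  apply: hu; first by apply: allpairs_uniq; rewrite ?undup_uniq // => -[? ?] [? ?].
  move=> [i j] ij; apply/allpairsP; exists (i, j); rewrite !mem_undup !mem_cat.
  by rewrite (map_f fst ij) (map_f snd ij) !orbT.
move: h3; rewrite sum_allpairs_mul.
move: h1 h2; set A := \sum_(i <- _) _; set B := \sum_(i <- _) _ => h1 h2 h3.
have -> : a * b - c = A * B - c - ((A - a) * (B - b) + (a * (B - b) + (A - a) * b)) by ring.
apply: le_trans (ler_normB _ _) _.
apply: le_trans (lerD (ltW h3) (le_trans (ler_normD _ _) (lerD (lexx _) (ler_normD _ _)))) _.
rewrite !CnormM.
have p1 : `|A - a| * `|B - b| <= d * 1 by apply: ler_pM => //; lra.
have p2 : `|a| * `|B - b| <= `|a| * d by apply: ler_wpM2l => //; lra.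
have p3 : `|A - a| * `|b| <= d * `|b| by apply: ler_wpM2r => //; lra.
lra.
Qed.

Lemma tsum_mul (I J : choiceType) (f : I -> Cpx) (g : J -> Cpx) :
  asummable f -> asummable g ->
  tsum f * tsum g = tsum (fun x : I * J => f x.1 * g x.2).
Proof. by move=> af ag; rewrite (tsum_eq (hasSum_mul af ag (tsumP af) (tsumP ag))). Qed.

(** Pairs (m, n) sorted by the parity of m + n. For odd a = 2m + 1 and b = 2n + 1, the left branch
    reads (2j + 1) + 2k, (2j + 1) - 2k and the right one 2j + (2k + 1), 2j - (2k + 1), which
    explains the shift by 1. *)
Definition Zdiag (x : int * int + int * int) : int * int :=
  match x with
  | inl (j, k) => (j + k, j - k)
  | inr (j, k) => (j + k, j - k - 1)
  end.

Definition Zdiag_inv (x : int * int) : int * int + int * int :=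
  let d := ((x.1 + x.2) %/ 2)%Z in
  if ((x.1 + x.2) %% 2)%Z == 0 then inl (d, x.1 - d) else inr (d + 1, x.1 - d - 1).

Lemma ZdiagK : cancel Zdiag Zdiag_inv.
Proof.
move=> [[j k]|[j k]]; rewrite /Zdiag_inv /=.
  have -> : j + k + (j - k) = j * 2 by ring.
  by rewrite modzMl mulzK // addrAC subrr add0r.
have -> : j + k + (j - k - 1) = (j - 1) * 2 + 1 by ring.
rewrite modzMDl divzMDl //= addr0 subrK; congr (inr (_, _)); ring.
Qed.

Lemma Zdiag_invK : cancel Zdiag_inv Zdiag.
Proof.
move=> [m n]; rewrite /Zdiag_inv /=.
have := divz_eq (m + n) 2; have := modz_ge0 (m + n) (isT : 2 != 0 :> int).
have := ltz_mod (m + n) (isT : 2 != 0 :> int).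
set d := ((m + n) %/ 2)%Z; set r := ((m + n) %% 2)%Z => h1 h2 h3.
case: eqP => [r0|/eqP r0] /=; congr (_, _); try ring.
  move: h3; rewrite r0; lra.
have r1 : r = 1 by move: h1 h2 r0; clear; case: r => [[|[|?]]|?].
move: h3; rewrite r1; lra.
Qed.

Lemma tsum_Zdiag (F : int * int -> Cpx) : asummable F ->
  tsum F = tsum (fun x : int * int => F (x.1 + x.2, x.1 - x.2))
         + tsum (fun x : int * int => F (x.1 + x.2, x.1 - x.2 - 1)).
Proof.
move=> aF; rewrite (tsum_sumtype ZdiagK Zdiag_invK aF).
by congr (_ + _); congr tsum; apply: funext => -[j k].
Qed.

(** * Limits and Euler products *)

Lemma CcvP (u : nat -> Cpx) l : Ccv u l <->
  forall e : R, 0 < e -> exists N, forall n, (N <= n)%N -> `|u n - l| < e.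
Proof.
split => h e e0.
  have [N hN] := h e (elimT RltP e0); exists N => n Nn; apply/RltP.
  by apply: hN; apply/ssrnat.leP.
have [N hN] := h e (introT RltP e0); exists N => n Nn; apply/RltP.
by apply: hN; apply/ssrnat.leP.
Qed.

Lemma Ccv_cst c : Ccv (fun=> c) c.
Proof. by apply/CcvP => e e0; exists 0 => n _; rewrite subrr normr0. Qed.

Lemma Ccv_shift (u : nat -> Cpx) l (s : nat -> nat) :
  (forall n, (n <= s n)%N) -> Ccv u l -> Ccv (fun n => u (s n)) l.
Proof.
move=> hs /CcvP h; apply/CcvP => e e0; have [N hN] := h _ e0; exists N => n Nn.
exact/hN/(leq_trans Nn).
Qed.

Lemma Ccv_near (u v : nat -> Cpx) l N0 :
  (forall n, (N0 <= n)%N -> u n = v n) -> Ccv u l -> Ccv v l.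
Proof.
move=> uv /CcvP h; apply/CcvP => e e0; have [N hN] := h _ e0.
exists (maxn N0 N) => n; rewrite geq_max => /andP[n1 n2].
by rewrite -uv // hN.
Qed.

Lemma Ccv_ext (u v : nat -> Cpx) l : u =1 v -> Ccv u l -> Ccv v l.
Proof. by move=> uv; apply: (@Ccv_near u v l 0) => n _. Qed.

Lemma CcvD u v l m : Ccv u l -> Ccv v m -> Ccv (fun n => u n + v n) (l + m).
Proof.
move=> /CcvP h /CcvP k; apply/CcvP => e e0; have e2 : 0 < e / 2 by lra.
have [N hN] := h _ e2; have [M hM] := k _ e2.
exists (maxn N M) => n; rewrite geq_max => /andP[n1 n2].
have := hN _ n1; have := hM _ n2 => h1 h2.
rewrite opprD addrACA; apply: le_lt_trans (ler_normD _ _) _; lra.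
Qed.

Lemma Ccv_bounded u l : Ccv u l -> exists2 M : R, 0 < M &
  exists N, forall n, (N <= n)%N -> `|u n| <= M.
Proof.
move=> /CcvP h; exists (`|l| + 1); first by have := normr_ge0 l; lra.
have [N hN] := h _ (ltr01); exists N => n /hN h1.
have := ler_normD (u n - l) l; rewrite subrK; lra.
Qed.

Lemma CcvM u v l m : Ccv u l -> Ccv v m -> Ccv (fun n => u n * v n) (l * m).
Proof.
move=> hu hv; have [M M0 [N0 hM]] := Ccv_bounded hv.
move/CcvP: hu => hu; move/CcvP: hv => hv; apply/CcvP => e e0.
have L0 : 0 < `|l| + 1 by have := normr_ge0 l; lra.
have e1 : 0 < e / (2 * M) by apply: divr_gt0 => //; lra.
have e2 : 0 < e / (2 * (`|l| + 1)) by apply: divr_gt0 => //; lra.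
have [N1 h1] := hu _ e1; have [N2 h2] := hv _ e2.
exists (maxn N0 (maxn N1 N2)) => n; rewrite !geq_max => /and3P[n0 n1 n2].
have -> : u n * v n - l * m = (u n - l) * v n + l * (v n - m) by ring.
apply: le_lt_trans (ler_normD _ _) _; rewrite !CnormM.
have a1 : `|u n - l| * `|v n| <= `|u n - l| * M by apply: ler_wpM2l; rewrite ?hM.
have a2 : `|u n - l| * M < e / 2.
  by have := h1 _ n1; rewrite ltr_pdivlMr ?mulr_gt0 //; lra.
have a3 : `|l| * `|v n - m| <= (`|l| + 1) * `|v n - m| by apply: ler_wpM2r => //; lra.
have a4 : (`|l| + 1) * `|v n - m| < e / 2.
  by have := h2 _ n2; rewrite ltr_pdivlMr ?mulr_gt0 //; lra.
lra.
Qed.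

Lemma CcvZ c u l : Ccv u l -> Ccv (fun n => c * u n) (c * l).
Proof. by apply: CcvM; apply: Ccv_cst. Qed.

Lemma CcvV u l : l != 0 -> Ccv u l -> Ccv (fun n => (u n)^-1) l^-1.
Proof.
move=> l0 /CcvP hu; apply/CcvP => e e0.
have L0 : 0 < `|l| by rewrite normr_gt0.
have e1 : 0 < Num.min (`|l| / 2) (e * (`|l| ^+ 2 / 2)).
  by rewrite lt_min; apply/andP; split; rewrite ?mulr_gt0 ?exprn_gt0 ?invr_gt0 //; lra.
have [N hN] := hu _ e1; exists N => n /hN; rewrite lt_min => /andP[h1 h2].
have un : `|l| / 2 < `|u n|.
  have := ler_normD (u n) (l - u n); rewrite addrC subrK distrC; lra.
have u0 : u n != 0 by rewrite -normr_gt0; lra.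
have -> : (u n)^-1 - l^-1 = - (u n - l) * ((u n)^-1 * l^-1).
  by field; rewrite u0 l0.
rewrite !CnormM normrN !CnormV.
have p : `|l| ^+ 2 / 2 < `|u n| * `|l|.
  by rewrite expr2 mulrAC ltr_pM2r.
rewrite -invfM ltr_pdivrMr; last by rewrite mulr_gt0 // normr_gt0.
by apply: lt_trans h2 _; rewrite ltr_pM2l.
Qed.

Lemma Ccv_sum (h : nat -> nat -> Cpx) (l : nat -> Cpx) K :
  (forall k, Ccv (fun N => h N k) (l k)) ->
  Ccv (fun N => \sum_(k < K) h N k) (\sum_(k < K) l k).
Proof.
move=> hl; elim: K => [|K IH].
  by rewrite big_ord0; apply: Ccv_ext (Ccv_cst 0) => n; rewrite big_ord0.
rewrite big_ord_recr; apply: Ccv_ext (CcvD IH (hl K)) => n.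
by rewrite big_ord_recr.
Qed.

Lemma Ccv_unique u l m : Ccv u l -> Ccv u m -> l = m.
Proof.
move=> /CcvP hl /CcvP hm; apply/eqP; rewrite -subr_eq0 -normr_le0 leNgt.
apply/negP => e0; have e2 : 0 < `|l - m| / 2 by lra.
have [N hN] := hl _ e2; have [M hM] := hm _ e2.
have := hN _ (leq_maxl N M); have := hM _ (leq_maxr N M).
set n := maxn N M => h1 h2.
have := ler_normD (l - u n) (u n - m); rewrite addrA subrK (distrC l (u n)); lra.
Qed.

Lemma Clim_eq u l : Ccv u l -> Clim u = l.
Proof.
move=> h; apply: (@Ccv_unique u) => //.
by apply: (ClassicalEpsilon.epsilon_spec (inhabits (RtoC 0)) (Ccv u)); exists l.
Qed.

Lemma Ccv_norm_le u l (M : R) : Ccv u l -> (forall n, `|u n| <= M) -> `|l| <= M.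
Proof.
move=> /CcvP h hM; apply/ler_addgt0Pr => e e0; have [N hN] := h _ e0.
have := hN _ (leqnn N); have := hM N; have := ler_normD (u N) (l - u N).
rewrite addrC subrK distrC; lra.
Qed.

Lemma Ccv_norm_ge u l (M : R) : Ccv u l -> (forall n, M <= `|u n|) -> M <= `|l|.
Proof.
move=> /CcvP h hM; apply/ler_addgt0Pr => e e0; have [N hN] := h _ e0.
have := hN _ (leqnn N); have := hM N; have := ler_normD (u N - l) l.
rewrite subrK; lra.
Qed.

(** * Series over the natural numbers, geometric domination and Tannery's theorem *)

Lemma sub_iota (s : seq nat) : {subset s <= iota 0 (\max_(i <- s) i).+1}.
Proof.
move=> i si; rewrite mem_iota add0n /= ltnS.
exact: (@leq_bigmax_seq _ _ _ id).
Qed.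

Lemma sum_iota_ord (V : nmodType) (f : nat -> V) n : \sum_(i <- iota 0 n) f i = \sum_(i < n) f i.
Proof. by rewrite -[n in iota _ n]subn0 -/(index_iota 0 n) big_mkord. Qed.

Lemma asummable_nat (V : normedZmodType R) (f : nat -> V) M :
  (forall N, \sum_(i < N) `|f i| <= M) -> asummable f.
Proof.
move=> hM; exists M => s us; apply: le_trans (hM (\max_(i <- s) i).+1).
rewrite -(sum_iota_ord (fun i => `|f i|)).
by apply: ler_sum_subset; rewrite ?iota_uniq //; apply: sub_iota.
Qed.

Lemma sum_geom_le (rho : R) N : 0 <= rho -> rho < 1 ->
  \sum_(i < N) rho ^+ i <= (1 - rho)^-1.
Proof.
move=> r0 r1; have d0 : 0 < 1 - rho by lra.
rewrite -[leRHS]mul1r ler_pdivlMr //.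
have -> : (\sum_(i < N) rho ^+ i) * (1 - rho) = 1 - rho ^+ N.
  by rewrite mulrC -[RHS]opprB subrX1; ring.
by have := exprn_ge0 N r0; lra.
Qed.

Lemma asummable_geom (rho C : R) : 0 <= rho -> rho < 1 ->
  asummable (fun i : nat => C * rho ^+ i).
Proof.
move=> r0 r1; apply: (@asummable_nat _ _ (`|C| * (1 - rho)^-1)) => N.
under eq_bigr do rewrite normrM normrX (ger0_norm r0).
by rewrite -mulr_sumr ler_wpM2l // sum_geom_le.
Qed.

(** With s the fourth root of rho, (n + 1) s^n <= 1 + s + ... + s^n <= 1/(1 - s). Three of the four
    factors s^n absorb the cube, and the last one keeps the geometric decay. *)
Lemma poly_geom_le (rho : R) : 0 <= rho -> rho < 1 -> exists C sigma : R,
  [/\ 0 <= C, 0 <= sigma, sigma < 1 & forall n : nat, n.+1%:R ^+ 3 * rho ^+ n <= C * sigma ^+ n].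
Proof.
move=> r0 r1; pose s := Num.sqrt (Num.sqrt rho).
have s0 : 0 <= s by apply: sqrtr_ge0.
have s4 : s ^+ 4 = rho by rewrite (exprM s 2 2) !sqr_sqrtr ?sqrtr_ge0.
have s1 : s < 1 by rewrite -(@ltr_pXn2r _ 4) ?nnegrE // s4 expr1n.
have d0 : 0 < 1 - s by lra.
exists ((1 - s)^-1 ^+ 3), s; split => //; first by rewrite exprn_ge0 // invr_ge0 ltW.
move=> n; rewrite -s4 -exprM mulnC exprM.
have h : n.+1%:R * s ^+ n <= (1 - s)^-1.
  apply: le_trans (sum_geom_le n.+1 s0 s1).
  rewrite -{1}(card_ord n.+1) -sumr_const mulr_suml.
  apply: ler_sum => i _; rewrite mul1r; apply: ler_wiXn2l => //; first exact: ltW.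
  by rewrite -ltnS.
have -> : n.+1%:R ^+ 3 * (s ^+ n) ^+ 4 = (n.+1%:R * s ^+ n) ^+ 3 * s ^+ n by ring.
apply: ler_wpM2r; first exact: exprn_ge0.
rewrite ler_pXn2r // nnegrE ?invr_ge0 ?mulr_ge0 ?exprn_ge0 //.
exact: ltW.
Qed.

Lemma Ccv_tsum (f : nat -> Cpx) : asummable f ->
  Ccv (fun N => \sum_(k < N) f k) (tsum f).
Proof.
move=> af; apply/CcvP => e e0; have [s hs] := tsumP af e0.
exists (\max_(i <- s) i).+1 => n hn; rewrite -sum_iota_ord.
apply: hs; rewrite ?iota_uniq // => i /sub_iota; rewrite !mem_iota /= => h.
exact: leq_trans h _.
Qed.

(** A head of fixed length converges termwise; what remains of the [N]-th sum is bounded by a tail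
    of [g], uniformly in [N], and [g] also dominates the limits. *)
Lemma tannery (h : nat -> nat -> Cpx) (l : nat -> Cpx) (g : nat -> R) :
  (forall N k, `|h N k| <= g k) -> asummable g ->
  (forall k, Ccv (fun N => h N k) (l k)) ->
  Ccv (fun N => \sum_(k < N.+1) h N k) (tsum l).
Proof.
move=> hg ag hl.
have gn k : `|g k| = g k by rewrite ger0_norm // (le_trans _ (hg 0 k)).
have al : asummable l.
  by apply: asummable_le ag => k; rewrite gn; apply: Ccv_norm_le (hl k) _.
apply/CcvP => e e0; have e4 : 0 < e / 4 by lra.
have [s us hs] := asummable_tail ag e4.
have /CcvP/(_ _ e4)[N0 hN0] := Ccv_tsum al.
pose K := maxn N0 (\max_(i <- s) i).+1.
have /CcvP/(_ _ e4)[N1 hN1] := Ccv_sum K hl.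
exists (maxn K N1) => N; rewrite geq_max => /andP[KN N1N].
have := hN1 _ N1N; have := hN0 K (leq_maxl _ _) => h1 h2.
have -> : \sum_(k < N.+1) h N k = \sum_(k < K) h N k + \sum_(k <- iota K (N.+1 - K)) h N k.
  rewrite -!(sum_iota_ord (h N)) -big_cat -[X in iota X (_ - _)]add0n -iotaD subnKC //.
  exact: leqW.
have h3 : `|\sum_(k <- iota K (N.+1 - K)) h N k| < e / 4.
  apply: le_lt_trans (ler_norm_sum _ _ _) _.
  apply: le_lt_trans (hs (iota K (N.+1 - K)) (iota_uniq _ _) _).
    by apply: ler_sum => i _; rewrite gn.
  move=> i; rewrite mem_iota => /andP[Ki _]; apply/negP => /sub_iota.
  rewrite mem_iota /= ltnNge => /negP; apply; apply: leq_trans Ki.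
  exact: leq_maxr.
set A := \sum_(k < K) h N k in h2 *; set B := \sum_(k < K) l k in h1 h2.
set D := \sum_(k <- _) _ in h3 *.
have -> : A + D - tsum l = (A - B) + (B - tsum l + D) by ring.
apply: le_lt_trans (le_trans (ler_normD _ _) (lerD (lexx _) (ler_normD _ _))) _.
lra.
Qed.

(** * Finite and infinite Euler products *)

Definition poch (x : Cpx) N := \prod_(k < N) (1 - x ^+ k.+1).

Lemma pochS x N : poch x N.+1 = poch x N * (1 - x ^+ N.+1).
Proof. by rewrite /poch big_ord_recr. Qed.

Lemma CpowE (z : Cpx) n : Cpow z n = z ^+ n.
Proof. by elim: n => [|n IH] //=; rewrite IH exprS. Qed.

Lemma qpartialE x N : qpartial x N = poch x N.
Proof.
elim: N => [|N IH]; first by rewrite /poch big_ord0.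
by rewrite pochS -IH -CpowE.
Qed.

Lemma prod_le_exp (f : nat -> R) N : (forall k, 0 <= 1 + f k) ->
  \prod_(k < N) (1 + f k) <= exp (\sum_(k < N) f k).
Proof.
move=> f0; elim: N => [|N IH]; first by rewrite !big_ord0 exp_0.
rewrite !big_ord_recr /= exp_plus; apply: ler_pM => //.
  by apply: prodr_ge0.
by apply/RleP; apply: exp_ineq1_le.
Qed.

Lemma exp_le (x y : R) : x <= y -> exp x <= exp y.
Proof.
rewrite le_eqVlt => /predU1P[->//|/RltP h]; apply/RleP; left; exact: exp_increasing.
Qed.

(** With r = |x|, both |1 - x^k| and its inverse are at most 1 + r^k/(1 - r), and the exponents
    r^k/(1 - r) sum to at most 1/(1 - r)^2. The lower bound is what keeps the infinite product away
    from 0. *)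
Lemma norm_poch_le (x : Cpx) : `|x| < 1 -> exists2 M : R, 0 < M &
  forall N, `|poch x N| <= M /\ M^-1 <= `|poch x N|.
Proof.
move=> x1; set r := `|x|; have r0 : 0 <= r := normr_ge0 x.
have d0 : 0 < 1 - r by rewrite subr_gt0.
have di : 0 <= (1 - r)^-1 by rewrite invr_ge0 ltW.
have d1 : 1 <= (1 - r)^-1 by rewrite invf_ge1 //; lra.
pose M : R := exp ((1 - r)^-1 * (1 - r)^-1).
have rk k : r ^+ k.+1 <= r by rewrite exprS ler_piMr // exprn_ile1 // ltW.
have rk0 k : 0 <= r ^+ k := exprn_ge0 k r0.
have sumle N : \sum_(k < N) (1 - r)^-1 * r ^+ k.+1 <= (1 - r)^-1 * (1 - r)^-1.
  rewrite -mulr_sumr ler_wpM2l //; apply: le_trans (sum_geom_le N r0 x1).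
  apply: ler_sum => i _; rewrite exprS ler_piMl //; exact: ltW.
have nx k : `|x ^+ k| = r ^+ k by rewrite CnormX.
exists M => [|N]; first by apply/RltP; apply: exp_pos.
have nprod n : `|poch x n| = \prod_(k < n) `|1 - x ^+ k.+1|.
  elim: n => [|n IH]; first by rewrite /poch !big_ord0 Cnorm1.
  by rewrite pochS CnormM IH big_ord_recr.
rewrite nprod; split.
  apply: (@le_trans _ _ (\prod_(k < N) (1 + (1 - r)^-1 * r ^+ k.+1))).
    apply: ler_prod => k _; rewrite normr_ge0 /=.
    apply: le_trans (ler_normB _ _) _; rewrite Cnorm1 nx lerD2l.
    by rewrite ler_peMl.
  apply: le_trans (exp_le (sumle N)); apply: (prod_le_exp (f := fun k => (1 - r)^-1 * r ^+ k.+1)) => k.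
  by have := mulr_ge0 di (rk0 k.+1); lra.
rewrite -[leRHS]invrK lef_pV2 ?posrE.
- rewrite -prodfV.
  apply: (@le_trans _ _ (\prod_(k < N) (1 + (1 - r)^-1 * r ^+ k.+1))).
    apply: ler_prod => k _; rewrite invr_ge0 normr_ge0 /=.
    have h1 : 1 - r ^+ k.+1 <= `|1 - x ^+ k.+1|.
      by rewrite -nx -{1}Cnorm1; apply: lerB_dist.
    have h2 := rk k; have h3 := rk0 k.+1.
    have h4 : 0 < 1 - r ^+ k.+1 by lra.
    apply: (@le_trans _ _ (1 - r ^+ k.+1)^-1); first by rewrite lef_pV2 ?posrE //; lra.
    have -> : (1 - r ^+ k.+1)^-1 = 1 + (1 - r ^+ k.+1)^-1 * r ^+ k.+1.
      by field; rewrite gt_eqF.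
    rewrite lerD2l ler_wpM2r // lef_pV2 ?posrE //; lra.
  apply: le_trans (exp_le (sumle N)); apply: (prod_le_exp (f := fun k => (1 - r)^-1 * r ^+ k.+1)) => k.
  by have := mulr_ge0 di (rk0 k.+1); lra.
- by apply/RltP; apply: exp_pos.
rewrite invr_gt0; apply: prodr_gt0 => k _; rewrite normr_gt0 subr_eq0.
apply/eqP => h; have := rk k; rewrite -nx -h Cnorm1; lra.
Qed.

Lemma poch_neq0 x N : `|x| < 1 -> poch x N != 0.
Proof.
move=> /norm_poch_le[M M0 /(_ N)[_ h]]; rewrite -normr_gt0.
by apply: lt_le_trans h; rewrite invr_gt0.
Qed.

(** Consecutive products differ by -x^(N+1) times the [N]-th one, so they are partial sums of a
    series dominated by a geometric one. *)
Lemma poch_cv x : `|x| < 1 -> qpoch_inf x != 0 /\ Ccv (poch x) (qpoch_inf x).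
Proof.
move=> x1; have [M M0 hM] := norm_poch_le x1.
have ad : asummable (fun k : nat => - (x ^+ k.+1) * poch x k).
  apply: (@asummable_le _ _ _ _ (fun k : nat => M * `|x| ^+ k)); last exact: asummable_geom.
  move=> k; rewrite CnormM normrN CnormX [leRHS]ger0_norm; last first.
    by rewrite mulr_ge0 ?exprn_ge0 // ltW.
  rewrite mulrC ler_pM ?exprn_ge0 //; first by have [] := hM k.
  by rewrite exprS ler_piMl ?exprn_ge0 // ltW.
have cv : Ccv (poch x) (1 + tsum (fun k : nat => - (x ^+ k.+1) * poch x k)).
  apply: Ccv_ext (CcvD (Ccv_cst 1) (Ccv_tsum ad)) => n.
  elim: n => [|n IH]; first by rewrite /poch !big_ord0 addr0.
  by rewrite big_ord_recr pochS -IH /=; ring.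
have -> : qpoch_inf x = 1 + tsum (fun k : nat => - (x ^+ k.+1) * poch x k).
  by apply: Clim_eq; apply: Ccv_ext cv => n; rewrite qpartialE.
split => //; rewrite -normr_gt0; apply: (@lt_le_trans _ _ M^-1).
  by rewrite invr_gt0.
by apply: Ccv_norm_ge cv _ => n; have [] := hM n.
Qed.

(** * The Jacobi triple product *)

Lemma tri_rec k : 'C(k.+2, 2) = ('C(k.+1, 2) + k.+1)%N.
Proof. by rewrite binS bin1. Qed.

Lemma tri_ge k : (k <= 'C(k.+1, 2))%N.
Proof. by case: k => [//|k]; rewrite tri_rec leq_addl. Qed.

(** Up to the factor [poch x (2 * N).+1], this is x^(k(k+1)/2) times the q-binomial coefficient of
    2N + 1 over N - k. The guard supplies the zeros for k > N that truncated subtraction would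
    lose. *)
Definition qcoef (x : Cpx) N k : Cpx :=
  if (k <= N)%N then x ^+ 'C(k.+1, 2) / (poch x (N - k) * poch x (N + k).+1) else 0.

Lemma one_sub_exp_neq0 (x : Cpx) n : `|x| < 1 -> 1 - x ^+ n.+1 != 0.
Proof.
move=> x1; have := poch_neq0 n.+1 x1; rewrite pochS mulf_eq0 negb_or.
by case/andP.
Qed.

(** Boundary case of [qcoef_rec]: under the symmetry k -> -1 - k the coefficient at -1 is the one at
    0, in accordance with p G(0) = G(0) + G(1). *)
Lemma qcoef_rec0 (x : Cpx) N : `|x| < 1 ->
  (1 - x ^+ (2 * N.+1)) * (1 - x ^+ (2 * N.+1).+1) * qcoef x N.+1 0 =
  (1 + x ^+ (2 * N.+1)) * qcoef x N 0 + x ^+ N.+1 * (qcoef x N 0 + qcoef x N 1).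
Proof.
move=> x1; rewrite /qcoef !leq0n !subn0 !addn0 (bin_small (isT : (1 < 2)%N)) binn expr0 expr1 /=.
have p0 := poch_neq0 N x1.
have a0 := one_sub_exp_neq0 N x1; have a1 := one_sub_exp_neq0 N.+1 x1.
case: N p0 a0 a1 => [|N] p0 a0 a1.
  rewrite !pochS /poch !big_ord0 /= in p0 a0 a1 *.
  rewrite !muln1 in p0 a0 a1 *; field; rewrite -?exprS.
  by rewrite a0 a1.
have p1 := poch_neq0 N x1.
rewrite subn1 addn1 /= !pochS (_ : (2 * N.+2)%N = (N.+2 + N.+2)%N); last by lia.
have a2 := one_sub_exp_neq0 N x1.
move: a0 a1 a2; rewrite !exprS exprD !exprS; set y := x ^+ N => a0 a1 a2.
by field; rewrite p1 a0 a1 a2.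
Qed.

(** Passage from 2N + 1 to 2N + 3 by q-Pascal rules, in the form that multiplication by 1 + p
    x^(N+1) + x^(2N+2) takes once [p] has been moved from the sequence [G] to the coefficients. *)
Lemma qcoef_rec (x : Cpx) N k : `|x| < 1 -> x != 0 ->
  (1 - x ^+ (2 * N.+1)) * (1 - x ^+ (2 * N.+1).+1) * qcoef x N.+1 k.+1 =
  (1 + x ^+ (2 * N.+1)) * qcoef x N k.+1 + x ^+ N.+1 * (qcoef x N k + qcoef x N k.+2).
Proof.
move=> x1 x0; have [kN|Nk] := leqP k N; last first.
  rewrite /qcoef (_ : (k.+1 <= N.+1)%N = false); last by lia.
  rewrite (_ : (k < N)%N = false); last by lia.
  rewrite (_ : (k <= N)%N = false); last by lia.
  rewrite (_ : (k.+1 < N)%N = false); last by lia.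
  by rewrite addr0 !mulr0 addr0.
move: kN => /subnK; move: (N - k)%N => i; move=> <- {N}.
rewrite /qcoef !tri_rec !exprD.
rewrite (_ : (k.+1 <= (i + k).+1)%N); last by lia.
rewrite (_ : (k <= i + k)%N); last by lia.
rewrite (_ : ((i + k).+1 - k.+1)%N = i); last by lia.
rewrite (_ : (i + k - k)%N = i); last by lia.
rewrite (_ : ((i + k).+1 + k.+1).+1 = (i + k + k).+3); last by lia.
rewrite (_ : (i + k + k.+1).+1 = (i + k + k).+2); last by lia.
rewrite (_ : (i + k + k.+2).+1 = (i + k + k).+3); last by lia.
rewrite (_ : (2 * (i + k).+1)%N = (i + i + k + k).+2); last by lia.
have pi := poch_neq0 i x1; have pk := poch_neq0 (i + k + k).+1 x1.
have a1 := one_sub_exp_neq0 (i + k + k).+1 x1.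
have a2 := one_sub_exp_neq0 (i + k + k).+2 x1.
have u0 : x ^+ k != 0 by rewrite expf_neq0.
rewrite (pochS _ (i + k + k).+2) (pochS _ (i + k + k).+1).
move: (poch x (i + k + k).+1) pk => P pk.
(* Here N = i + k; for i = 0 and i = 1 some of the guards at k + 1 and k + 2 cut off, so these cases
   are separate. *)
case: i pi a1 a2 => [|[|i]] pi a1 a2.
- rewrite (_ : (k < 0 + k)%N = false); last by lia.
  rewrite (_ : (k.+1 < 0 + k)%N = false); last by lia.
  rewrite !add0n in a1 a2 *.
  move: a1 a2; rewrite !exprS !exprD; set u := x ^+ k in u0 * => a1 a2.
  by field; rewrite pi pk a1 a2.
- rewrite (_ : (k < 1 + k)%N = true); last by lia.
  rewrite (_ : (k.+1 < 1 + k)%N = false); last by lia.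
  rewrite (_ : (1 + k - k.+1)%N = 0%N); last by lia.
  have a3 := one_sub_exp_neq0 0 x1.
  move: a1 a2 a3; rewrite !pochS /poch !big_ord0 !add1n !addSn !exprS !exprD expr0 !mulr1.
  set u := x ^+ k in u0 * => a1 a2 a3.
  by field; rewrite pk a1 a2 a3.
rewrite (_ : (k < i.+2 + k)%N = true); last by lia.
rewrite (_ : (k.+1 < i.+2 + k)%N = true); last by lia.
rewrite (_ : (i.+2 + k - k.+1)%N = i.+1); last by lia.
rewrite (_ : (i.+2 + k - k.+2)%N = i); last by lia.
have a3 := one_sub_exp_neq0 i x1; have a4 := one_sub_exp_neq0 i.+1 x1.
have pi0 := poch_neq0 i x1.
rewrite !pochS; move: a1 a2 a3 a4; rewrite !addSn !addnS !exprS !exprD.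
set u := x ^+ k in u0 *; set y := x ^+ i => a1 a2 a3 a4.
by field; rewrite pk pi0 a1 a2 a3 a4.
Qed.

(* Finite form of the Jacobi triple product: [G] is, up to a factor, the sequence
   of symmetric Laurent polynomials (-1)^k (z^-k + ... + z^k), with p = -(z + 1/z). *)
Lemma finite_triple_product (x p : Cpx) (G : nat -> Cpx) N : `|x| < 1 -> x != 0 ->
  G 1%N = (p - 1) * G 0%N -> (forall k, G k.+2 = p * G k.+1 - G k) ->
  poch x (2 * N).+1 * \sum_(k < N.+1) G k * qcoef x N k =
  G 0%N * \prod_(n < N) (1 + p * x ^+ n.+1 + x ^+ (2 * n.+1)).
Proof.
move=> x1 x0 G1 GS; elim: N => [|N IH].
  rewrite big_ord_recl !big_ord0 /qcoef /= pochS /poch big_ord0 bin_small //.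
  have a0 := one_sub_exp_neq0 0 x1; rewrite expr1 in a0 *.
  by field.
rewrite [\prod_(n < N.+1) _]big_ord_recr /= [RHS]mulrA -IH.
rewrite (_ : (2 * N.+1).+1 = (2 * N).+3); last by lia.
rewrite 2!pochS (_ : (2 * N).+2 = (2 * N.+1)%N); last by lia.
rewrite -2!mulrA -[RHS]mulrA; congr (_ * _).
rewrite mulrA mulr_sumr.
pose h k := if k is k'.+1 then qcoef x N k' + qcoef x N k'.+2
            else qcoef x N 0 + qcoef x N 1.
(* Summation by parts: the recurrence of [G] trades the factor [p] for the two neighbours of each
   coefficient. The boundary terms vanish at n = N + 1, where the coefficients are already zero. *)
have telescope n : \sum_(k < n.+1) G k * h k = p * (\sum_(k < n.+1) G k * qcoef x N k)
     + (G n * qcoef x N n.+1 - G n.+1 * qcoef x N n).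
  elim: n => [|n IHn]; first by rewrite !big_ord_recr !big_ord0 /= G1; ring.
  by rewrite big_ord_recr IHn [X in _ = p * X + _]big_ord_recr /= GS; ring.
have q1 : qcoef x N N.+1 = 0 by rewrite /qcoef ltnn.
have q2 : qcoef x N N.+2 = 0 by rewrite /qcoef leqNgt ltnS leqnSn.
have -> : \sum_(i < N.+2) (1 - x ^+ (2 * N.+1)) * (1 - x ^+ (2 * N.+1).+1) *
    (G i * qcoef x N.+1 i) = \sum_(i < N.+2) (((1 + x ^+ (2 * N.+1)) * (G i * qcoef x N i))
    + x ^+ N.+1 * (G i * h i)).
  apply: eq_bigr => -[[|k] ?] _ /=; rewrite mulrCA ?qcoef_rec0 // ?qcoef_rec //; ring.
rewrite big_split /= -!mulr_sumr telescope q1 q2 big_ord_recr /= q1; ring.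
Qed.

(** The domination for [tannery]: Euler products are bounded above and below, and k <= k(k+1)/2
    leaves a geometric factor. *)
Lemma qcoef_norm (x : Cpx) : `|x| < 1 -> exists2 M : R, 0 <= M &
  forall N k, `|poch x (2 * N).+1 * qcoef x N k| <= M * `|x| ^+ k.
Proof.
move=> x1; have [M M0 hM] := norm_poch_le x1.
exists (M * (M * M)) => [|N k]; first by rewrite !mulr_ge0 ?ltW.
have r0 := exprn_ge0 k (normr_ge0 x).
rewrite /qcoef; case: ifP => _; last by rewrite mulr0 normr0 mulr_ge0 // !mulr_ge0 // ltW.
rewrite !CnormM CnormV CnormM CnormX.
have iM n : `|poch x n|^-1 <= M.
  by rewrite -[leRHS]invrK lef_pV2 ?posrE ?invr_gt0 ?normr_gt0 ?poch_neq0 //; case: (hM n).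
have xk : `|x| ^+ 'C(k.+1, 2) <= `|x| ^+ k.
  by apply: ler_wiXn2l; rewrite ?normr_ge0 ?tri_ge // ltW.
rewrite -[leRHS]mulrA [X in _ <= _ * X]mulrC; apply: ler_pM => //.
- by rewrite mulr_ge0 ?exprn_ge0 // invr_ge0 mulr_ge0.
- by case: (hM (2 * N).+1).
apply: ler_pM; rewrite ?exprn_ge0 ?invr_ge0 ?mulr_ge0 //.
by rewrite invfM; apply: ler_pM; rewrite ?invr_ge0.
Qed.

(** Each normalised coefficient tends to x^(k(k+1)/2) divided by the infinite product. Linear growth
    of [G] is allowed because the coefficients in Jacobi's identity grow linearly. *)
Lemma triple_product (x p : Cpx) (G : nat -> Cpx) (K : R) : `|x| < 1 -> x != 0 ->
  G 1%N = (p - 1) * G 0%N -> (forall k, G k.+2 = p * G k.+1 - G k) ->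
  (forall k, `|G k| <= K * k.+1%:R) ->
  Ccv (fun N => G 0%N * poch x N * \prod_(n < N) (1 + p * x ^+ n.+1 + x ^+ (2 * n.+1)))
      (tsum (fun k => G k * x ^+ 'C(k.+1, 2))).
Proof.
move=> x1 x0 G1 GS GK.
have [P0 Pcv] := poch_cv x1; set P := qpoch_inf x in P0 Pcv.
have [M M0 hM] := qcoef_norm x1.
have K0 : 0 <= K by have := GK 0%N; rewrite mulr1; apply: le_trans.
have [C [s [C0 s0 s1 hs]]] := poly_geom_le (normr_ge0 x) x1.
have bound k : k.+1%:R * `|x| ^+ k <= C * s ^+ k.
  apply: le_trans (hs k); apply: ler_wpM2r; first exact: exprn_ge0.
  by rewrite -[leLHS]expr1 ler_weXn2l // ler1n.
pose g k := (K * M * C) * s ^+ k.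
have cvk k : Ccv (fun N => G k * (poch x (2 * N).+1 * qcoef x N k))
                 (G k * (x ^+ 'C(k.+1, 2) / P)).
  apply: CcvZ.
  have c1 : Ccv (fun N => poch x (2 * N).+1) P by apply: Ccv_shift Pcv => n; lia.
  have c2 : Ccv (fun N => poch x (N + k).+1) P by apply: Ccv_shift Pcv => n; lia.
  have c3 : Ccv (fun N => poch x (N - k)) P.
    apply/CcvP => e e0; move/CcvP: Pcv => /(_ _ e0)[N0 hN0].
    by exists (N0 + k)%N => n hn; apply: hN0; lia.
  have PP : P * P != 0 by rewrite mulf_neq0.
  have c4 := CcvM c1 (CcvZ (x ^+ 'C(k.+1, 2)) (CcvV PP (CcvM c3 c2))).
  have -> : x ^+ 'C(k.+1, 2) / P = P * (x ^+ 'C(k.+1, 2) * (P * P)^-1) by field.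
  apply: (@Ccv_near _ _ _ k) c4 => n kn; by rewrite /qcoef kn.
have gb N k : `|G k * (poch x (2 * N).+1 * qcoef x N k)| <= g k.
  rewrite CnormM; apply: (@le_trans _ _ ((K * k.+1%:R) * (M * `|x| ^+ k))).
    exact: ler_pM.
  have := ler_wpM2l (mulr_ge0 K0 M0) (bound k); rewrite /g; lra.
have ag : asummable g by apply: asummable_geom.
have := CcvZ P (tannery gb ag cvk).
have -> : P * tsum (fun k => G k * (x ^+ 'C(k.+1, 2) / P)) = tsum (fun k => G k * x ^+ 'C(k.+1, 2)).
  rewrite -tsumZ; first by congr tsum; apply: funext => k; field.
  apply: asummable_le ag => k; rewrite ger0_norm; last by rewrite !mulr_ge0 ?exprn_ge0.
  by apply: (Ccv_norm_le (cvk k)).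
move=> cv.
(* Since [poch x N / P] tends to 1, the limit [P] may be exchanged for the finite product in the
   statement. *)
have := CcvM (CcvZ P^-1 Pcv) cv.
rewrite mulVf // mul1r; apply: Ccv_ext => N.
have -> : \sum_(k < N.+1) G k * (poch x (2 * N).+1 * qcoef x N k) =
   G 0%N * \prod_(n < N) (1 + p * x ^+ n.+1 + x ^+ (2 * n.+1)).
  rewrite -(finite_triple_product N x1 x0 G1 GS) mulr_sumr.
  by apply: eq_bigr => i _; rewrite mulrCA.
by field.
Qed.

(** * Theta series *)

Lemma tsumB (I : choiceType) (f g : I -> Cpx) : asummable f -> asummable g ->
  tsum (fun i => f i - g i) = tsum f - tsum g.
Proof. by move=> hf hg; apply: tsum_eq; apply: hasSumD; [|apply: hasSumN]; apply: tsumP. Qed.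

(** * Sums over the integers, split by sign and by parity *)

Definition int_of_sum (x : nat + nat) : int :=
  match x with inl n => Posz n | inr n => Negz n end.
Definition sum_of_int (m : int) : nat + nat :=
  match m with Posz n => inl n | Negz n => inr n end.
Lemma int_of_sumK : cancel int_of_sum sum_of_int. Proof. by case. Qed.
Lemma sum_of_intK : cancel sum_of_int int_of_sum. Proof. by case. Qed.

Lemma asummable_int (V : normedZmodType R) (f : int -> V) :
  asummable (fun n : nat => f (Posz n)) -> asummable (fun n : nat => f (Negz n)) -> asummable f.
Proof.
move=> h1 h2.
have := @asummable_sumtype _ _ _ (fun x => f (int_of_sum x)) h1 h2.
move=> /(@asummable_inj _ _ _ sum_of_int _ (can_inj sum_of_intK)).
by congr asummable; apply: funext => m; rewrite sum_of_intK.
Qed.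

Lemma tsum_int (f : int -> Cpx) : asummable f ->
  tsum f = tsum (fun n : nat => f (Posz n)) + tsum (fun n : nat => f (Negz n)).
Proof. by move=> af; rewrite (tsum_sumtype int_of_sumK sum_of_intK af). Qed.

Definition int_of_parity (x : int + int) : int :=
  match x with inl m => 2 * m | inr m => 2 * m + 1 end.
Definition parity_of_int (n : int) : int + int :=
  if (n %% 2)%Z == 0 then inl (n %/ 2)%Z else inr (n %/ 2)%Z.
Lemma int_of_parityK : cancel int_of_parity parity_of_int.
Proof.
case=> m; rewrite /parity_of_int /= (mulrC 2 m); first by rewrite modzMl mulzK.
by rewrite modzMDl divzMDl //= addr0.
Qed.
Lemma parity_of_intK : cancel parity_of_int int_of_parity.
Proof.
move=> n; rewrite /parity_of_int.
have := divz_eq n 2; have := modz_ge0 n (isT : 2 != 0 :> int).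
have := ltz_mod n (isT : 2 != 0 :> int).
by case: eqP => /=; lia.
Qed.

Lemma tsum_parity (f : int -> Cpx) : asummable f ->
  tsum f = tsum (fun m => f (2 * m)) + tsum (fun m => f (2 * m + 1)).
Proof. by move=> af; rewrite (tsum_sumtype int_of_parityK parity_of_intK af). Qed.

(** The weight n^k has two sources: k = 2 is the effect of r d/dr on r^(n^2), and k = 1 arises from
    (u + v)^2 - (u - v)^2 = 4 u v in the Wronskian. *)
Definition gterm (k : nat) (z r : Cpx) (n : int) : Cpx :=
  n%:~R ^+ k * (z ^ n * r ^ (n ^+ 2)).

Definition gsum (b : int) k z r := tsum (fun m : int => gterm k z r (2 * m + b)).

Lemma Cnorm_expz (z : Cpx) (n : int) : `|z| = 1 -> `|z ^ n| = 1.
Proof.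
move=> z1; case: n => n; first by rewrite -exprnP CnormX z1 expr1n.
by rewrite NegzE -exprnN CnormV CnormX z1 expr1n invr1.
Qed.

Lemma Cnorm_nat n : `|n%:R : Cpx| = n%:R.
Proof. by rewrite normrMn Cnorm1. Qed.

Lemma Cnorm_int (n : int) : `|n%:~R : Cpx| = `|n|%N%:R.
Proof. by case: n => n; rewrite ?NegzE ?mulrNz ?normrN Cnorm_nat. Qed.

Lemma exprz_sqr (r : Cpx) (n : int) : r ^ (n ^+ 2) = r ^+ (`|n| ^ 2)%N.
Proof. by rewrite -[n ^+ 2]gez0_abs ?sqr_ge0 // abszX. Qed.

(** The cubic allowance on the coefficients leaves room for the weights that differentiation and its
    remainder estimate produce. *)
Lemma asummable_nat_pow (c : int -> Cpx) (e : int -> nat) (r : Cpx) :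
  `|r| < 1 -> (forall m, (`|m| <= e m)%N) -> (forall m, `|c m| <= (e m).+1%:R ^+ 3) ->
  asummable (fun m => c m * r ^+ e m).
Proof.
move=> r1 he hc; have [C [s [C0 s0 s1 hs]]] := poly_geom_le (normr_ge0 r) r1.
have [M hM] : asummable (fun m : int => C * s ^+ `|m|%N).
  apply: asummable_int; first exact: asummable_geom.
  apply: asummable_le (asummable_geom C s0 s1) => n.
  rewrite !ger0_norm ?mulr_ge0 ?exprn_ge0 // ler_wpM2l //.
  by rewrite ler_wiXn2l // ?ltW //; lia.
apply: (@asummable_le _ _ _ _ (fun m : int => C * s ^+ `|m|%N)); last by exists M.
move=> m; rewrite [leRHS]ger0_norm ?mulr_ge0 ?exprn_ge0 // CnormM CnormX.
apply: le_trans (ler_wpM2r (exprn_ge0 _ (normr_ge0 r)) (hc m)) _.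
apply: le_trans (hs _) _; rewrite ler_wpM2l // ler_wiXn2l ?he //; exact: ltW.
Qed.

Lemma leq_sqr n : (n <= n ^ 2)%N.
Proof. by case: n => // n; rewrite leq_pmulr. Qed.

Lemma asummable_gterm k (z r : Cpx) : (k <= 2)%N -> `|z| = 1 -> `|r| < 1 -> asummable (gterm k z r).
Proof.
move=> k2 z1 r1.
have : asummable (fun m : int => (m%:~R ^+ k * z ^ m) * r ^+ (`|m| ^ 2)%N).
  apply: asummable_nat_pow => // m; first exact: leq_sqr.
  rewrite CnormM Cnorm_expz // mulr1 CnormX Cnorm_int.
  apply: (@le_trans _ _ ((`|m| ^ 2).+1%:R ^+ k)).
    by apply: lerXn2r; rewrite ?nnegrE ?ler0n // ler_nat (leq_trans (leq_sqr _)).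
  by apply: ler_weXn2l; rewrite ?ler1n //; apply: leqW.
by congr asummable; apply: funext => m; rewrite /gterm exprz_sqr mulrA.
Qed.

Lemma double_inj (b : int) : injective (fun m : int => 2 * m + b).
Proof. by move=> m n; lia. Qed.

Lemma asummable_gterm2 b k (z r : Cpx) : (k <= 2)%N -> `|z| = 1 -> `|r| < 1 ->
  asummable (fun m : int => gterm k z r (2 * m + b)).
Proof.
move=> k2 z1 r1; apply: (@asummable_inj _ _ _ (fun m : int => 2 * m + b)).
  exact: double_inj.
exact: asummable_gterm.
Qed.

Definition cross k l (x y r : Cpx) (u v : int) := gterm k x r (u + v) * gterm l y r (u - v).

(** The variables separate: x^(u+v) y^(u-v) = (x y)^u (x/y)^v, and in (u + v)^2 + (u - v)^2 = 2 u^2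
    + 2 v^2 the mixed terms cancel, so the nome becomes r^2. *)
Lemma crossE k l (x y r : Cpx) u v : x != 0 -> y != 0 -> r != 0 ->
  cross k l x y r u v = (u%:~R + v%:~R) ^+ k * (u%:~R - v%:~R) ^+ l *
    (gterm 0 (x * y) (r ^+ 2) u * gterm 0 (x / y) (r ^+ 2) v).
Proof.
move=> x0 y0 r0; rewrite /cross /gterm !expr0 !mul1r intrD intrB.
rewrite !expfzDr // (exprnP r 2) !exprz_exp !(expfzMl x).
rewrite (_ : (u + v) ^+ 2 = u ^+ 2 + v ^+ 2 + 2 * (u * v)); last by ring.
rewrite (_ : (u - v) ^+ 2 = u ^+ 2 + v ^+ 2 + 2 * (- (u * v))); last by ring.
rewrite !expfzDr // (_ : 2 * - (u * v) = - (2 * (u * v))); last by ring.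
rewrite exprz_inv -!invr_expz.
rewrite (_ : Posz 2 * u ^+ 2 = u ^+ 2 + u ^+ 2); last by ring.
rewrite (_ : Posz 2 * v ^+ 2 = v ^+ 2 + v ^+ 2); last by ring.
rewrite !expfzDr //.
have yv := expfz_neq0 v y0; have := expfz_neq0 (2 * (u * v)) r0.
set a := (_ ^+ k); set b := (_ ^+ l); move: (_ ^ (2 * (u * v))) => w w0.
by field; rewrite w0 yv.
Qed.

Lemma asummable_cross (a b : int) k l (x y r : Cpx) : (k <= 2)%N -> (l <= 2)%N ->
  `|x| = 1 -> `|y| = 1 -> `|r| < 1 ->
  asummable (fun m : int * int => cross k l x y r (2 * m.1 + a) (2 * m.2 + b)).
Proof.
move=> k2 l2 x1 y1 r1.
have := asummable_mul (asummable_gterm k2 x1 r1) (asummable_gterm l2 y1 r1).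
pose h (m : int * int) := (2 * m.1 + a + (2 * m.2 + b), 2 * m.1 + a - (2 * m.2 + b)).
apply: (@asummable_inj _ _ _ h).
by move=> [m n] [m' n'] [] h1 h2; congr (_, _); lia.
Qed.

(* With odd indices written as u + v and u - v, exactly one of u, v is odd. *)
Lemma gsum_mul k l (x y r : Cpx) : (k <= 2)%N -> (l <= 2)%N -> `|x| = 1 -> `|y| = 1 -> `|r| < 1 ->
  gsum 1 k x r * gsum 1 l y r =
    tsum (fun m : int * int => cross k l x y r (2 * m.1 + 1) (2 * m.2 + 0))
  + tsum (fun m : int * int => cross k l x y r (2 * m.1 + 0) (2 * m.2 + 1)).
Proof.
move=> k2 l2 x1 y1 r1; rewrite /gsum tsum_mul; try exact: asummable_gterm2.
rewrite tsum_Zdiag; last exact: (asummable_mul (asummable_gterm2 1 k2 x1 r1) (asummable_gterm2 1 l2 y1 r1)).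
congr (_ + _); congr tsum; apply: funext => -[m n] /=;
  by rewrite /cross; congr (gterm _ _ _ _ * gterm _ _ _ _); ring.
Qed.

Lemma Cnorm_eq1_neq0 (x : Cpx) : `|x| = 1 -> x != 0.
Proof. by move=> x1; rewrite -normr_gt0 x1 ltr01. Qed.

Lemma Cnorm_sqr_lt1 (r : Cpx) : `|r| < 1 -> `|r ^+ 2| < 1.
Proof. by move=> r1; rewrite CnormX exprn_ilt1. Qed.

Lemma tsum_gterm_mul a b k l (x y r : Cpx) : (k <= 2)%N -> (l <= 2)%N ->
  `|x| = 1 -> `|y| = 1 -> `|r| < 1 ->
  tsum (fun m : int * int => gterm k x r (2 * m.1 + a) * gterm l y r (2 * m.2 + b)) =
  gsum a k x r * gsum b l y r.
Proof. by move=> k2 l2 x1 y1 r1; rewrite /gsum tsum_mul //; apply: asummable_gterm2. Qed.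

Lemma gsum_mul00 (x y r : Cpx) : `|x| = 1 -> `|y| = 1 -> `|r| < 1 -> r != 0 ->
  gsum 1 0 x r * gsum 1 0 y r =
    gsum 1 0 (x * y) (r ^+ 2) * gsum 0 0 (x / y) (r ^+ 2)
  + gsum 0 0 (x * y) (r ^+ 2) * gsum 1 0 (x / y) (r ^+ 2).
Proof.
move=> x1 y1 r1 r0; have [x0 y0] := (Cnorm_eq1_neq0 x1, Cnorm_eq1_neq0 y1).
have xy : `|x * y| = 1 by rewrite CnormM x1 y1 mulr1.
have xdy : `|x / y| = 1 by rewrite CnormM CnormV x1 y1 invr1 mulr1.
have r2 := Cnorm_sqr_lt1 r1.
have z2 : (0 <= 2)%N by [].
apply: etrans (gsum_mul z2 z2 x1 y1 r1) _; apply: esym.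
rewrite -(tsum_gterm_mul 1 0 z2 z2 xy xdy r2) -(tsum_gterm_mul 0 1 z2 z2 xy xdy r2).
by congr (_ + _); congr tsum; apply: funext => m; rewrite crossE // !expr0 !mul1r.
Qed.

(** The weights (u + v)^2 and (u - v)^2 differ by 4 u v, which gives one linear weight to each
    factor. The left side is the Wronskian for r d/dr. *)
Lemma gsum_wronskian (x y r : Cpx) : `|x| = 1 -> `|y| = 1 -> `|r| < 1 -> r != 0 ->
  gsum 1 2 x r * gsum 1 0 y r - gsum 1 0 x r * gsum 1 2 y r =
    4 * (gsum 1 1 (x * y) (r ^+ 2) * gsum 0 1 (x / y) (r ^+ 2)
       + gsum 0 1 (x * y) (r ^+ 2) * gsum 1 1 (x / y) (r ^+ 2)).
Proof.
move=> x1 y1 r1 r0; have [x0 y0] := (Cnorm_eq1_neq0 x1, Cnorm_eq1_neq0 y1).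
have xy : `|x * y| = 1 by rewrite CnormM x1 y1 mulr1.
have xdy : `|x / y| = 1 by rewrite CnormM CnormV x1 y1 invr1 mulr1.
have r2 := Cnorm_sqr_lt1 r1.
have E u v : cross 2 0 x y r u v - cross 0 2 x y r u v =
    4 * (gterm 1 (x * y) (r ^+ 2) u * gterm 1 (x / y) (r ^+ 2) v).
  by rewrite !crossE // /gterm; ring.
have [z2 o2 d2] : [/\ (0 <= 2)%N, (1 <= 2)%N & (2 <= 2)%N] by [].
have S a b : tsum (fun m : int * int => cross 2 0 x y r (2 * m.1 + a) (2 * m.2 + b))
    - tsum (fun m : int * int => cross 0 2 x y r (2 * m.1 + a) (2 * m.2 + b)) =
    4 * (gsum a 1 (x * y) (r ^+ 2) * gsum b 1 (x / y) (r ^+ 2)).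
  rewrite -(tsumB (asummable_cross a b d2 z2 x1 y1 r1) (asummable_cross a b z2 d2 x1 y1 r1)).
  rewrite -(tsum_gterm_mul a b o2 o2 xy xdy r2).
  rewrite -(tsumZ _ (asummable_mul (asummable_gterm2 a o2 xy r2) (asummable_gterm2 b o2 xdy r2))).
  by congr tsum; apply: funext => m; apply: E.
apply: etrans (congr2 (fun a b => a - b) (gsum_mul d2 z2 x1 y1 r1) (gsum_mul z2 d2 x1 y1 r1)) _.
by rewrite opprD addrACA (S 1 0) (S 0 1) mulrDr.
Qed.

Lemma gsumV b k (z r : Cpx) : (k <= 2)%N -> `|z| = 1 -> `|r| < 1 ->
  gsum b k z^-1 r = (-1) ^+ k * gsum b k z r.
Proof.
move=> k2 z1 r1; rewrite /gsum -tsumZ; last exact: asummable_gterm2.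
(* In terms of the index 2m + b this is the reflection n -> -n, which preserves the parity class. *)
pose h (m : int) := - m - b.
have hK : cancel h h by move=> m; rewrite /h; ring.
rewrite -(tsum_reindex _ hK hK); congr tsum; apply: funext => m.
rewrite /gterm (_ : 2 * h m + b = - (2 * m + b)); last by rewrite /h; ring.
by rewrite exprz_inv opprK sqrrN mulrNz (exprNn (2 * m + b)%:~R) -mulrA.
Qed.

Lemma gsumN b k (z r : Cpx) : (k <= 2)%N -> `|z| = 1 -> `|r| < 1 ->
  gsum b k (- z) r = (-1) ^ b * gsum b k z r.
Proof.
move=> k2 z1 r1; rewrite /gsum -tsumZ; last exact: asummable_gterm2.
congr tsum; apply: funext => m; rewrite /gterm -[in LHS](mulN1r z) expfzMl.
rewrite expfzDr ?oppr_eq0 ?oner_neq0 // -exprz_exp.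
rewrite (_ : (-1) ^ 2 = 1); last by rewrite -exprnP; ring.
by rewrite exp1rz; ring.
Qed.

(** Halving the even index makes it unrestricted, at parameter z^2 and nome r^4; then it is split by
    parity. *)
Lemma gsum0_split k (z r : Cpx) : (k <= 2)%N -> `|z| = 1 -> `|r| < 1 ->
  gsum 0 k z r = 2 ^+ k * (gsum 0 k (z ^+ 2) (r ^+ 4) + gsum 1 k (z ^+ 2) (r ^+ 4)).
Proof.
move=> k2 z1 r1.
have z2 : `|z ^+ 2| = 1 by rewrite CnormX z1 expr1n.
have r4 : `|r ^+ 4| < 1 by rewrite CnormX exprn_ilt1.
rewrite /gsum.
rewrite (_ : (fun m : int => gterm k (z ^+ 2) (r ^+ 4) (2 * m + 0)) =
   (fun m : int => gterm k (z ^+ 2) (r ^+ 4) (2 * m))); last first.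
  by apply: funext => m; rewrite addr0.
rewrite -(tsum_parity (asummable_gterm k2 z2 r4)) -tsumZ; last exact: asummable_gterm.
congr tsum; apply: funext => m; rewrite /gterm addr0 intrM exprMn (exprnP z) (exprnP r).
rewrite !exprz_exp (_ : (2 * m) ^+ 2 = 4 * m ^+ 2); last by ring.
by rewrite -mulrA.
Qed.

(** Joint coefficient of the opposite indices 2n + 1 and -(2n + 1), which share the same power of
    [r]. *)
Definition fold_coef k (z : Cpx) n : Cpx :=
  (2 * n + 1)%:R ^+ k * (z ^+ (2 * n + 1) + (-1) ^+ k * z ^- (2 * n + 1)).

Lemma sqr_odd_tri n : ((2 * n + 1) ^ 2 = 8 * 'C(n.+1, 2) + 1)%N.
Proof. by elim: n => [//|n IH]; rewrite tri_rec; lia. Qed.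

(** An odd square is 8 times a triangular number plus 1, hence the prefactor [r] and the base
    [r ^+ 8]. *)
Lemma gsum1_fold k (z r : Cpx) : (k <= 2)%N -> `|z| = 1 -> `|r| < 1 ->
  gsum 1 k z r = r * tsum (fun n => fold_coef k z n * (r ^+ 8) ^+ 'C(n.+1, 2)).
Proof.
move=> k2 z1 r1; have az := asummable_gterm2 1 k2 z1 r1.
rewrite /gsum tsum_int // -tsumD; last first.
- by apply: (asummable_inj (h := Negz)) az => m n [].
- by apply: (asummable_inj (h := Posz)) az => m n [].
have E (n : nat) : gterm k z r (2 * Posz n + 1) + gterm k z r (2 * Negz n + 1) =
    r * (fold_coef k z n * (r ^+ 8) ^+ 'C(n.+1, 2)).
  rewrite (_ : 2 * Negz n + 1 = - (2 * n + 1)%N%:Z); last by lia.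
  rewrite (_ : 2 * Posz n + 1 = (2 * n + 1)%N%:Z); last by lia.
  rewrite /gterm /fold_coef mulrNz sqrrN -exprnN -exprnP -exprM.
  rewrite -[X in r ^ X](_ : ((2 * n + 1) ^ 2)%N%:Z = _); last by lia.
  rewrite -exprnP sqr_odd_tri (exprD r) expr1.
  rewrite (exprNn (2 * n + 1)%N%:~R) -!pmulrn. ring.
rewrite (_ : (fun n => _) = (fun n => r * (fold_coef k z n * (r ^+ 8) ^+ 'C(n.+1, 2)))); last first.
  by apply: funext => n; apply: E.
(* Summability of the folded series is obtained below by dividing by [r], so the value 0 is treated
   apart. *)
have [->|r0] := eqVneq r 0.
  rewrite mul0r; apply: tsum_eq => e e0; exists [::] => t _ _.
  by rewrite big1 ?subr0 ?normr0 // => i _; rewrite mul0r.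
rewrite tsumZ //.
have : asummable (fun n : nat => r^-1 * (gterm k z r (2 * Posz n + 1) + gterm k z r (2 * Negz n + 1))).
  apply: asummableZ; apply: asummableD.
    by apply: (asummable_inj (h := Posz)) az => m n [].
  by apply: (asummable_inj (h := Negz)) az => m n [].
by congr asummable; apply: funext => n; rewrite E mulKf.
Qed.

Lemma gsum1_product k (z r p : Cpx) : (k <= 1)%N -> `|z| = 1 -> `|r| < 1 -> r != 0 ->
  fold_coef k z 1 = (p - 1) * fold_coef k z 0 ->
  (forall n, fold_coef k z n.+2 = p * fold_coef k z n.+1 - fold_coef k z n) ->
  Ccv (fun N => r * (fold_coef k z 0 * poch (r ^+ 8) N *
         \prod_(n < N) (1 + p * (r ^+ 8) ^+ n.+1 + (r ^+ 8) ^+ (2 * n.+1))))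
      (gsum 1 k z r).
Proof.
move=> k1 z1 r1 r0 G1 GS; rewrite gsum1_fold ?(leq_trans k1) //; apply: CcvZ.
(* The weight is at most 2 (n + 1) and the bracket has norm at most 2, which gives the constant
   4. *)
apply: (triple_product (K := 4%:R)) G1 GS _.
- by rewrite CnormX exprn_ilt1.
- by rewrite expf_neq0.
move=> n; rewrite /fold_coef CnormM CnormX Cnorm_nat.
have h : `|z ^+ (2 * n + 1) + (-1) ^+ k * z ^- (2 * n + 1)| <= 2.
  apply: le_trans (ler_normD _ _) _; rewrite CnormM CnormV !CnormX normrN Cnorm1 z1 !expr1n.
  by rewrite invr1 mulr1; lra.
have h2 : (2 * n + 1)%:R ^+ k <= 2 * n.+1%:R :> R.
  case: k k1 {h} => [|[|//]] _; rewrite ?expr0 ?expr1 -natrM ?ler1n ?ler_nat; lia.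
have := ler_pM (exprn_ge0 k (ler0n _ _)) (normr_ge0 _) h2 h. lra.
Qed.

(** * Complex derivatives *)

Definition isD (f : Cpx -> Cpx) (z l : Cpx) := forall e : R, 0 < e ->
  exists2 d : R, 0 < d & forall h, `|h| < d -> `|f (z + h) - f z - l * h| <= e * `|h|.

Lemma isD_Cderiv_lim f z l : isD f z l -> Cderiv_lim f z l.
Proof.
move=> H e ep; have e0 : 0 < e := introT RltP ep.
have e2 : 0 < e / 2 by lra.
have [d d0 hd] := H _ e2; exists d; split; first exact/RltP.
move=> h /eqP h0 /RltP hh; apply/RltP; have hb := hd h hh.
have n0 : 0 < `|h| by rewrite normr_gt0.
apply: (@le_lt_trans _ _ (e / 2)); last by lra.
change (`|(f (z + h) - f z) / h - l| <= e / 2).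
have -> : (f (z + h) - f z) / h - l = (f (z + h) - f z - l * h) / h by field.
by rewrite CnormM CnormV ler_pdivrMr.
Qed.

Lemma isD_near f g z l d0 : 0 < d0 -> (forall h, `|h| < d0 -> f (z + h) = g (z + h)) ->
  isD f z l -> isD g z l.
Proof.
move=> p0 fg H e e0; have [d dp hd] := H _ e0.
exists (Num.min d d0); first by rewrite lt_min dp p0.
move=> h; rewrite lt_min => /andP[h1 h2].
have z0 : f z = g z by have := fg 0; rewrite normr0 addr0 => ->.
by rewrite -fg // -z0; apply: hd.
Qed.

Lemma isD_lip f z l : isD f z l ->
  exists2 d : R, 0 < d & forall h, `|h| < d -> `|f (z + h) - f z| <= (`|l| + 1) * `|h|.
Proof.
move=> /(_ _ ltr01)[d d0 hd]; exists d => // h /hd h1.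
have := ler_normD (f (z + h) - f z - l * h) (l * h); rewrite subrK CnormM; lra.
Qed.

Lemma isD_comp f g z l m : isD g z m -> isD f (g z) l -> isD (fun x => f (g x)) z (l * m).
Proof.
move=> Hg Hf e e0; have [d1 d10 h1] := isD_lip Hg.
have m0 : 0 < `|m| + 1 by have := normr_ge0 m; lra.
have l0 : 0 < `|l| + 1 by have := normr_ge0 l; lra.
have a0 : 0 < e / (2 * (`|m| + 1)) by rewrite divr_gt0 // mulr_gt0.
have b0 : 0 < e / (2 * (`|l| + 1)) by rewrite divr_gt0 // mulr_gt0.
have [d2 d20 h2] := Hf _ a0; have [d3 d30 h3] := Hg _ b0.
exists (Num.min d1 (Num.min d3 (d2 / (`|m| + 1)))).
  by rewrite !lt_min d10 d30 divr_gt0.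
move=> h; rewrite !lt_min => /and3P[hd1 hd3 hd2].
have k1 := h1 _ hd1; have k3 := h3 _ hd3.
set k := g (z + h) - g z in k1.
have kd : `|k| < d2 by apply: le_lt_trans k1 _; move: hd2; rewrite ltr_pdivlMr // mulrC.
have k2 := h2 _ kd; rewrite (_ : g z + k = g (z + h)) in k2; last by rewrite /k addrC subrK.
have -> : f (g (z + h)) - f (g z) - l * m * h =
   (f (g (z + h)) - f (g z) - l * k) + l * (k - m * h) by ring.
apply: le_trans (ler_normD _ _) _; rewrite CnormM.
have p1 : e / (2 * (`|m| + 1)) * `|k| <= e / 2 * `|h|.
  apply: le_trans (ler_wpM2l (ltW a0) k1) _.
  by rewrite mulrA invfM mulrA divfK ?gt_eqF.
have p2 : `|l| * `|k - m * h| <= e / 2 * `|h|.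
  apply: (@le_trans _ _ ((`|l| + 1) * (e / (2 * (`|l| + 1)) * `|h|))).
    by apply: ler_pM => //; lra.
  by rewrite invfM !mulrA [X in X * `|h|](_ : _ = e / 2) //; field; rewrite gt_eqF.
lra.
Qed.

Lemma isD_mul f g z l m : isD f z l -> isD g z m ->
  isD (fun x => f x * g x) z (l * g z + f z * m).
Proof.
move=> Hf Hg e e0; have [d1 d10 h1] := isD_lip Hg.
pose A := `|g z| + `|m| + 1; pose B := `|f z| + 1; pose L := `|l| * (`|m| + 1) + 1.
have m0 : 0 <= `|m| := normr_ge0 m; have l0 : 0 <= `|l| := normr_ge0 l.
have A0 : 0 < A by rewrite /A; have := normr_ge0 (g z); lra.
have B0 : 0 < B by rewrite /B; have := normr_ge0 (f z); lra.
have L0 : 0 < L by rewrite /L; have := mulr_ge0 l0 (addr_ge0 m0 ler01); lra.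
have a0 : 0 < e / (3 * A) by rewrite divr_gt0 // mulr_gt0.
have b0 : 0 < e / (3 * B) by rewrite divr_gt0 // mulr_gt0.
have [d2 d20 h2] := Hf _ a0; have [d3 d30 h3] := Hg _ b0.
exists (Num.min 1 (Num.min (e / (3 * L)) (Num.min d1 (Num.min d2 d3)))).
  by rewrite !lt_min ltr01 d10 d20 d30 divr_gt0 ?mulr_gt0.
move=> h; rewrite !lt_min => /and5P[hh1 hL hd1 hd2 hd3].
have k1 := h1 _ hd1; have k2 := h2 _ hd2; have k3 := h3 _ hd3.
have -> : f (z + h) * g (z + h) - f z * g z - (l * g z + f z * m) * h =
  (f (z + h) - f z - l * h) * g (z + h) + (l * h * (g (z + h) - g z)
   + f z * (g (z + h) - g z - m * h)) by ring.
apply: le_trans (ler_normD _ _) (le_trans (lerD (lexx _) (ler_normD _ _)) _).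
rewrite !CnormM.
have h0 : 0 <= `|h| := normr_ge0 h.
have gb : `|g (z + h)| <= A.
  have := ler_normD (g (z + h) - g z) (g z); rewrite subrK.
  have : (`|m| + 1) * `|h| <= (`|m| + 1) * 1 by apply: ler_wpM2l; lra.
  rewrite /A; lra.
have p1 : `|f (z + h) - f z - l * h| * `|g (z + h)| <= e / 3 * `|h|.
  apply: le_trans (ler_pM _ _ k2 gb) _ => //.
  by rewrite invfM mulrA mulrAC divfK ?gt_eqF.
have p3 : `|f z| * `|g (z + h) - g z - m * h| <= e / 3 * `|h|.
  apply: (@le_trans _ _ (B * (e / (3 * B) * `|h|))).
    by apply: ler_pM => //; rewrite /B; lra.
  by rewrite invfM !mulrA [X in X * `|h|](_ : _ = e / 3) //; field; rewrite gt_eqF.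
have p2 : `|l| * `|h| * `|g (z + h) - g z| <= e / 3 * `|h|.
  apply: (@le_trans _ _ (`|l| * `|h| * ((`|m| + 1) * `|h|))).
    by rewrite ler_wpM2l // mulr_ge0.
  rewrite (_ : _ * _ * _ = (`|l| * (`|m| + 1) * `|h|) * `|h|); last by ring.
  rewrite ler_wpM2r //; apply: (@le_trans _ _ (L * (e / (3 * L)))).
    by apply: ler_pM => //; rewrite ?mulr_ge0 ?addr_ge0 // ?ltW // /L; lra.
  by rewrite le_eqVlt; apply/orP; left; apply/eqP; field; rewrite gt_eqF.
lra.
Qed.

Lemma isD_inv a : a != 0 -> isD (fun x => x^-1) a (- a^-1 ^+ 2).
Proof.
move=> a0 e e0; have n0 : 0 < `|a| by rewrite normr_gt0.
have c0 : 0 < `|a| ^+ 3 by rewrite exprn_gt0.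
exists (Num.min (`|a| / 2) (e * `|a| ^+ 3 / 2)).
  by rewrite lt_min; apply/andP; split; [lra|rewrite divr_gt0 ?mulr_gt0].
move=> h; rewrite lt_min => /andP[h1 h2].
have b : `|a| / 2 < `|a + h| by have := ler_normB (a + h) h; rewrite addrK; lra.
have ah : a + h != 0 by rewrite -normr_gt0; lra.
have -> : (a + h)^-1 - a^-1 - - a^-1 ^+ 2 * h = h * (h / (a ^+ 2 * (a + h))).
  by field; rewrite a0 ah.
rewrite CnormM mulrC ler_wpM2r // CnormM CnormV CnormM CnormX.
rewrite ler_pdivrMr; last by rewrite mulr_gt0 ?exprn_gt0 // normr_gt0.
have : `|a| ^+ 2 * (`|a| / 2) <= `|a| ^+ 2 * `|a + h|.
  by rewrite ler_wpM2l ?exprn_ge0 // ltW.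
have -> : `|a| ^+ 2 * (`|a| / 2) = `|a| ^+ 3 / 2 by field.
move=> /(ler_wpM2l (ltW e0)); lra.
Qed.

(** The forms [r ^+ n / r] and the factor [s ^+ 2] stand for exponents n - 1 and n - 2 without
    truncated subtraction. The remainders satisfy R(n+1) = (r + h) R(n) + n r^(n-1) h^2, and n^2 + n
    <= (n + 1)^2. *)
Lemma pow_taylor_bound (r h : Cpx) (s : R) n : r != 0 -> `|r| <= s -> `|r + h| <= s ->
  `|(r + h) ^+ n - r ^+ n - n%:R * r ^+ n / r * h| * s ^+ 2 <= n%:R ^+ 2 * s ^+ n * `|h| ^+ 2.
Proof.
move=> r0 rs rhs; have s0 : 0 <= s := le_trans (normr_ge0 _) rs.
elim: n => [|n IH]; first by rewrite !expr0 !mul0r subrr subr0 normr0 expr0n !mul0r.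
have -> : (r + h) ^+ n.+1 - r ^+ n.+1 - n.+1%:R * r ^+ n.+1 / r * h =
   (r + h) * ((r + h) ^+ n - r ^+ n - n%:R * r ^+ n / r * h)
   + n%:R * r ^+ n / r * h ^+ 2.
  by rewrite !exprS -natr1; field.
set A := _ - _ - _ in IH *.
have H0 : 0 <= `|h| ^+ 2 by rewrite exprn_ge0.
have b2 : `|n%:R * r ^+ n / r * h ^+ 2| * s ^+ 2 <= n%:R * s ^+ n.+1 * `|h| ^+ 2.
  case: n {IH A} => [|n]; first by rewrite !mul0r normr0 !mul0r.
  rewrite (_ : n.+1%:R * r ^+ n.+1 / r = n.+1%:R * r ^+ n); last by rewrite exprS; field.
  rewrite !CnormM Cnorm_nat !CnormX.
  have q1 : `|r| ^+ n <= s ^+ n by apply: lerXn2r; rewrite ?nnegrE.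
  have q2 : 0 <= n.+1%:R * `|h| ^+ 2 * s ^+ 2 by rewrite !mulr_ge0 ?exprn_ge0 ?ler0n.
  by move: (ler_wpM2l q2 q1); rewrite !exprS; lra.
apply: (@le_trans _ _ ((`|(r + h) * A| + `|n%:R * r ^+ n / r * h ^+ 2|) * s ^+ 2)).
  by rewrite ler_wpM2r ?exprn_ge0 // ler_normD.
rewrite mulrDl CnormM.
have b1 : `|r + h| * `|A| * s ^+ 2 <= s * (n%:R ^+ 2 * s ^+ n * `|h| ^+ 2).
  by rewrite -mulrA; apply: ler_pM; rewrite ?mulr_ge0 ?exprn_ge0.
have b3 : 0 <= (n%:R + 1) * s ^+ n.+1 * `|h| ^+ 2.
  by rewrite !mulr_ge0 ?exprn_ge0 // addr_ge0 ?ler0n.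
rewrite -natr1; move: b1 b2 b3; rewrite !exprS; lra.
Qed.

(** Termwise differentiation: on a disc of radius [s] between |r| and 1 the second-order remainders
    are dominated by a convergent series times |h|^2. *)
Lemma isD_power_series (c : int -> Cpx) (e : int -> nat) (r : Cpx) :
  r != 0 -> `|r| < 1 -> (forall m, (`|m| <= e m)%N) -> (forall m, `|c m| <= 1) ->
  isD (fun x => tsum (fun m => c m * x ^+ e m)) r
      (tsum (fun m => c m * (e m)%:R * r ^+ e m) / r).
Proof.
move=> r0 r1 he hc; pose s := (`|r| + 1) / 2.
have rn : 0 < `|r| by rewrite normr_gt0.
have [s0 s1 rs] : [/\ 0 < s, s < 1 & `|r| < s] by rewrite /s; split; lra.
have le1 m k : (k <= 3)%N -> ((e m)%:R ^+ k : R) <= (e m).+1%:R ^+ 3.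
  move=> k3; apply: (@le_trans _ _ ((e m).+1%:R ^+ k)).
    by apply: lerXn2r; rewrite ?nnegrE ?ler0n // ler_nat.
  by apply: ler_weXn2l => //; rewrite ler1n.
have as0 (x : Cpx) : `|x| < 1 -> asummable (fun m => c m * x ^+ e m).
  move=> x1; apply: asummable_nat_pow => // m; apply: le_trans (hc m) _.
  by have := le1 m 0%N isT; rewrite expr0.
have as1 k (x : Cpx) : (k <= 3)%N -> `|x| < 1 -> asummable (fun m => c m * (e m)%:R ^+ k * x ^+ e m).
  move=> k3 x1; apply: asummable_nat_pow => // m; rewrite CnormM CnormX Cnorm_nat.
  by apply: le_trans (le1 m k k3); rewrite ler_piMl ?exprn_ge0.
have [M hM] : asummable (fun m => c m * (e m)%:R ^+ 2 * (RtoC s) ^+ e m).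
  by apply: as1 => //; rewrite Cnorm_RtoC ger0_norm // ltW.
have M0 : 0 <= M by have := hM [::] isT; rewrite big_nil.
have M1 : 0 < M + 1 by lra.
(* The first bound keeps r + h in the disc of radius [s]; the second makes M |h|^2 / s^2 at most eps
   |h|. *)
move=> eps eps0; exists (Num.min (s - `|r|) (eps * s ^+ 2 / (M + 1))).
  by rewrite lt_min subr_gt0 rs divr_gt0 // mulr_gt0 ?exprn_gt0.
move=> h; rewrite lt_min => /andP[h1 h2].
have rhs : `|r + h| <= s by apply: le_trans (ler_normD _ _) _; lra.
have rh1 : `|r + h| < 1 by lra.
have as1r : asummable (fun m => c m * (e m)%:R * r ^+ e m).
  by have := as1 1%N r isT r1; congr asummable; apply: funext => m; rewrite expr1.
rewrite [_ / r](mulrC _ r^-1) -mulrA [_ * h]mulrC mulrA -tsumZ //.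
rewrite -(tsumB (as0 _ rh1) (as0 _ r1)) -tsumB; last exact: asummableZ.
  pose A n := (r + h) ^+ n - r ^+ n - n%:R * r ^+ n / r * h.
  rewrite (_ : (fun m => _) = (fun m => c m * A (e m))); last first.
    by apply: funext => m; rewrite /A; field.
  have s20 : 0 < s ^+ 2 by rewrite exprn_gt0.
  apply: (@le_trans _ _ (M * `|h| ^+ 2 / s ^+ 2)); last first.
    rewrite ler_pdivrMr //; move: h2; rewrite ltr_pdivlMr // => h2.
    have := ler_wpM2r (normr_ge0 h) (ltW h2).
    have := mulr_ge0 (normr_ge0 h) (normr_ge0 h); rewrite (expr2 `|h|); lra.
  apply: tsum_norm_le => t ut; rewrite ler_pdivlMr // mulr_suml.
  apply: (@le_trans _ _ (\sum_(m <- t) `|c m * (e m)%:R ^+ 2 * RtoC s ^+ e m| * `|h| ^+ 2)).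
    apply: ler_sum => m _; rewrite !CnormM !CnormX Cnorm_nat Cnorm_RtoC (gtr0_norm s0).
    have := ler_wpM2l (normr_ge0 (c m)) (pow_taylor_bound (e m) r0 (ltW rs) rhs).
    by rewrite -/(A (e m)) !mulrA.
  by rewrite -mulr_suml ler_wpM2r ?exprn_ge0 // hM.
have := asummableD (as0 _ rh1) (asummableZ (-1) (as0 _ r1)).
by congr asummable; apply: funext => m; rewrite mulN1r.
Qed.

Lemma isD_gsum1 (z r : Cpx) : `|z| = 1 -> `|r| < 1 -> r != 0 ->
  isD (gsum 1 0 z) r (gsum 1 2 z r / r).
Proof.
move=> z1 r1 r0; pose e (m : int) : nat := expn (absz (2 * m + 1)) 2.
have E k x : gsum 1 k z x = tsum (fun m : int => (2 * m + 1)%:~R ^+ k * (z ^ (2 * m + 1) * x ^+ e m)).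
  by congr tsum; apply: funext => m; rewrite /gterm exprz_sqr.
have he m : (`|m| <= e m)%N by rewrite /e; nia.
have hc (m : int) : `|z ^ (2 * m + 1)| <= 1 by rewrite Cnorm_expz.
have := isD_power_series r0 r1 he hc.
have -> : (fun x => tsum (fun m : int => z ^ (2 * m + 1) * x ^+ e m)) = gsum 1 0 z.
  by apply: funext => x; rewrite E; congr tsum; apply: funext => m; rewrite expr0 mul1r.
congr isD; congr (_ / _); rewrite E; congr tsum; apply: funext => m.
rewrite mulrA (mulrC (_ ^+ 2)); congr (_ * _ * _).
by rewrite -rmorphXn /= /e pmulrn; congr (_%:~R); lia.
Qed.

(** * The exponential *)

Lemma CexpD z w : Cexp (z + w) = Cexp z * Cexp w.
Proof.
by apply: Cpx_eq; rewrite /= exp_plus ?cos_plus ?sin_plus !RE; ring.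
Qed.

Lemma Cexp0 : Cexp 0 = 1.
Proof. by apply: Cpx_eq; rewrite /= exp_0 ?cos_0 ?sin_0 !RE ?mulr1 ?mulr0. Qed.

Lemma Cexp_neq0 z : Cexp z != 0.
Proof.
apply/eqP => h; have := CexpD z (- z); rewrite subrr Cexp0 h mul0r => /eqP.
by rewrite oner_eq0.
Qed.

Lemma CexpN z : Cexp (- z) = (Cexp z)^-1.
Proof.
apply: (mulfI (Cexp_neq0 z)); rewrite -CexpD subrr Cexp0 divff //; exact: Cexp_neq0.
Qed.

Lemma CexpMn z n : Cexp (z * n%:R) = Cexp z ^+ n.
Proof.
elim: n => [|n IH]; first by rewrite mulr0 Cexp0.
by rewrite -natr1 mulrDr mulr1 CexpD IH exprSr.
Qed.

Lemma CexpMz z (n : int) : Cexp (z * n%:~R) = Cexp z ^ n.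
Proof.
case: n => n; first by rewrite -exprnP -CexpMn.
by rewrite NegzE mulrNz mulrN CexpN -exprnN -CexpMn.
Qed.

Lemma norm_Cexp z : `|Cexp z| = exp (Re z).
Proof.
have e0 : 0 <= exp (Re z) by apply/RleP; left; apply: exp_pos.
apply/eqP; rewrite -(@eqrXn2 _ 2) ?normr_ge0 // Cabs_sqr /Cnorm2 /= !RE.
have := sin2_cos2 (Im z); rewrite /Rsqr !RE => sc.
apply/eqP; rewrite expr2; set a := exp _; set c := cos _ in sc *; set s := sin _ in sc *.
have -> : a * c * (a * c) + a * s * (a * s) = a * a * (s * s + c * c) by ring.
by rewrite sc mulr1.
Qed.

Lemma real_deriv0 (f : R -> R) (l : R) : derivable_pt_lim f 0 l ->
  forall e : R, 0 < e -> exists2 d : R, 0 < d &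
    forall x : R, `|x| < d -> `|f x - f 0 - l * x| <= e * `|x|.
Proof.
move=> H e e0; have [[d dp] hd] := H e (elimT RltP e0).
exists d; first exact/RltP.
move=> x xd; have [->|x0] := eqVneq x 0.
  by rewrite mulr0 subr0 subrr normr0 mulr0.
have := hd x (elimN eqP x0) (elimT RltP xd); rewrite /= !RE add0r RdivE.
move=> /RltP h; change (is_true (`|(f x - f 0) / x - l| < e)) in h.
have -> : f x - f 0 - l * x = ((f x - f 0) / x - l) * x by field.
by rewrite normrM ler_wpM2r // ltW.
Qed.

(** Assembled from the real derivatives of exp, cos and sin at 0; other points follow from the
    functional equation in [isD_Cexp]. *)
Lemma isD_Cexp0 : isD Cexp 0 1.
Proof.
move=> e ep.
have [e' [e0 e1 e8]] : exists e' : R, [/\ 0 < e', e' <= 1 & e' <= e / 8].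
  (* The real part will cost 3 e' and the imaginary part 5 e', together 8 e'; the bound by 1 is used
     for the cruder estimates. *)
  exists (Num.min 1 (e / 8)); rewrite lt_min !ge_min !lexx ltr01 orbT; split => //.
  by rewrite divr_gt0.
have [d1 d10 h1] := real_deriv0 (derivable_pt_lim_exp 0) e0.
have [d2 d20 h2] := real_deriv0 (derivable_pt_lim_cos 0) e0.
have [d3 d30 h3] := real_deriv0 (derivable_pt_lim_sin 0) e0.
exists (Num.min e' (Num.min d1 (Num.min d2 d3))).
  by rewrite !lt_min e0 d10 d20 d30.
move=> h; rewrite !lt_min => /and4P[he hd1 hd2 hd3].
have xh := Cnorm_Re h; have yh := Cnorm_Im h.
have := h1 _ (le_lt_trans xh hd1); have := h2 _ (le_lt_trans yh hd2).
have := h3 _ (le_lt_trans yh hd3).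
rewrite exp_0 sin_0 cos_0 !RE !mul1r !subr0 oppr0 mul0r ?subr0 => k3 k2 k1.
rewrite add0r Cexp0; apply: le_trans (Cnorm_le _) _; rewrite /= !RE ?oppr0 ?subr0 ?addr0.
set x := Re h in xh k1 *; set y := Im h in yh k2 k3 *.
have x0 := normr_ge0 x; have y0 := normr_ge0 y; have h0 := normr_ge0 h.
have E : `|exp x - 1| <= 2 * `|x|.
  have := ler_normD (exp x - 1 - x) x; rewrite subrK => /le_trans; apply.
  by have := ler_wpM2r x0 e1; lra.
have Sy : `|sin y| <= 2 * `|y|.
  have := ler_normD (sin y - y) y; rewrite subrK => /le_trans; apply.
  by have := ler_wpM2r y0 e1; lra.
have C1 : `|cos y| <= 1.
  have [/RleP a /RleP b] := COS_bound y; rewrite ler_norml; apply/andP; split => //.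
have X1 : `|x| <= 1 by lra.
have p1 : `|exp x * cos y - 1 - x| <= 3 * e' * `|h|.
  have -> : exp x * cos y - 1 - x = (exp x - 1 - x) * cos y + (1 + x) * (cos y - 1) by ring.
  apply: le_trans (ler_normD _ _) _; rewrite !normrM.
  have q1 : `|exp x - 1 - x| * `|cos y| <= e' * `|h| * 1.
    by apply: ler_pM => //; apply: le_trans k1 _; rewrite ler_wpM2l // ltW.
  have q2 : `|1 + x| * `|cos y - 1| <= 2 * (e' * `|h|).
    apply: ler_pM => //; last by apply: le_trans k2 _; rewrite ler_wpM2l // ltW.
    by apply: le_trans (ler_normD _ _) _; rewrite normr1; lra.
  lra.
have p2 : `|exp x * sin y - y| <= 5 * e' * `|h|.
  have -> : exp x * sin y - y = (exp x - 1) * sin y + (sin y - y) by ring.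
  apply: le_trans (ler_normD _ _) _; rewrite normrM.
  have q1 : `|exp x - 1| * `|sin y| <= (2 * e') * (2 * `|h|).
    by apply: ler_pM => //; [apply: le_trans E _|apply: le_trans Sy _]; lra.
  have q2 : `|sin y - y| <= e' * `|h|.
    by apply: le_trans k3 _; rewrite ler_wpM2l // ltW.
  lra.
have := ler_wpM2r h0 e8; lra.
Qed.

Lemma isD_Cexp (w z : Cpx) : isD (fun t => Cexp (w * t)) z (w * Cexp (w * z)).
Proof.
move=> e e0; have E0 : 0 < `|Cexp (w * z)| by rewrite normr_gt0 Cexp_neq0.
have W0 : 0 < `|w| + 1 by have := normr_ge0 w; lra.
have e1 : 0 < e / (`|Cexp (w * z)| * (`|w| + 1)) by rewrite divr_gt0 ?mulr_gt0.
have [d d0 hd] := isD_Cexp0 e1; exists (d / (`|w| + 1)); first by rewrite divr_gt0.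
move=> h; rewrite ltr_pdivlMr // => hh.
have wh : `|w * h| <= (`|w| + 1) * `|h| by rewrite CnormM ler_wpM2r //; lra.
have := hd (w * h) (le_lt_trans wh _); rewrite mulrC => /(_ hh).
rewrite add0r Cexp0 mul1r => k.
rewrite mulrDr CexpD.
have -> : Cexp (w * z) * Cexp (w * h) - Cexp (w * z) - w * Cexp (w * z) * h =
  Cexp (w * z) * (Cexp (w * h) - 1 - w * h) by ring.
rewrite CnormM; apply: le_trans (ler_wpM2l (ltW E0) k) _.
apply: (@le_trans _ _ (`|Cexp (w * z)| * (e / (`|Cexp (w * z)| * (`|w| + 1)) * ((`|w| + 1) * `|h|)))).
  by rewrite ler_wpM2l ?(ltW E0) // ler_wpM2l // ltW.
rewrite le_eqVlt; apply/orP; left; apply/eqP; field.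
by rewrite !gt_eqF.
Qed.

Lemma Zsum_eq (f : Z -> Cpx) (g : int -> Cpx) : asummable g ->
  (forall n : nat, f (Z.of_nat n) = g (Posz n)) ->
  (forall n : nat, f (Z.opp (Z.of_nat n.+1)) = g (Negz n)) -> Zsum f = tsum g.
Proof.
move=> ag h1 h2; apply: Clim_eq; rewrite (tsum_int ag).
have a1 : asummable (fun n : nat => g (Posz n)) by apply: (asummable_inj (h := Posz)) ag => m n [].
have a2 : asummable (fun n : nat => g (Negz n)) by apply: (asummable_inj (h := Negz)) ag => m n [].
(* The [N]-th symmetric partial sum has N + 1 nonnegative indices but N negative ones, hence the
   shift in this half. *)
have c1 : Ccv (fun N => \sum_(k < N.+1) g (Posz k)) (tsum (fun n : nat => g (Posz n))).
  by apply: (@Ccv_shift (fun N => \sum_(k < N) g (Posz k))) (Ccv_tsum a1) => n.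
apply: Ccv_ext (CcvD c1 (Ccv_tsum a2)) => N.
elim: N => [|N IH]; first by rewrite big_ord_recr !big_ord0 /= add0r addr0 -h1.
have -> : Zpartial f N.+1 = Zpartial f N + (f (Z.of_nat N.+1) + f (Z.opp (Z.of_nat N.+1))) by [].
by rewrite -IH h1 h2 big_ord_recr [X in _ + X = _]big_ord_recr /= addrACA.
Qed.

(** * Product evaluations *)

Lemma prod_one_add_exp (x : Cpx) N : `|x| < 1 ->
  \prod_(n < N) (1 + x ^+ n.+1) = poch (x ^+ 2) N / poch x N.
Proof.
move=> x1; have p0 := poch_neq0 N x1; apply: (mulIf p0); rewrite divfK //.
(* Factor by factor this is (1 + y)(1 - y) = 1 - y^2. *)
rewrite /poch -big_split; apply: eq_bigr => i _ /=.
by rewrite -exprM mulnC exprM; ring.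
Qed.

Lemma eq_opp_eq0 (a : Cpx) : a = - a -> a = 0.
Proof.
move=> e; have : `|a *+ 2| = 0 by rewrite mulr2n {1}e addNr normr0.
by rewrite normrMn => /eqP; rewrite mulrn_eq0 /= normr_eq0 => /eqP.
Qed.

Lemma pow_lt1 (x : Cpx) n : `|x| < 1 -> (0 < n)%N -> `|x ^+ n| < 1.
Proof. by move=> x1 n0; rewrite CnormX exprn_ilt1 // -lt0n. Qed.

Lemma fold_coef0_rec (z : Cpx) n : z != 0 -> fold_coef 0 z n.+2 =
  (z ^+ 2 + z ^- 2) * fold_coef 0 z n.+1 - fold_coef 0 z n.
Proof.
move=> z0; rewrite /fold_coef !expr0.
rewrite (_ : (2 * n.+2 + 1)%N = (2 * n + 1).+4); last by lia.
rewrite (_ : (2 * n.+1 + 1)%N = (2 * n + 1).+2); last by lia.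
rewrite !exprS; have := expf_neq0 (2 * n + 1) z0; set u := z ^+ _ => u0.
by field; rewrite z0 u0.
Qed.

Lemma fold_coef0_1 (z : Cpx) : z != 0 ->
  fold_coef 0 z 1 = (z ^+ 2 + z ^- 2 - 1) * fold_coef 0 z 0.
Proof. by move=> z0; rewrite /fold_coef !expr0 /=; field. Qed.

Lemma gsum1_product0 (z r : Cpx) : `|z| = 1 -> `|r| < 1 -> r != 0 ->
  Ccv (fun N => r * ((z + z^-1) * poch (r ^+ 8) N *
    \prod_(n < N) (1 + (z ^+ 2 + z ^- 2) * (r ^+ 8) ^+ n.+1 + (r ^+ 8) ^+ (2 * n.+1))))
    (gsum 1 0 z r).
Proof.
move=> z1 r1 r0; have z0 := Cnorm_eq1_neq0 z1.
have -> : z + z^-1 = fold_coef 0 z 0 by rewrite /fold_coef !expr0 /= !expr1; ring.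
apply: gsum1_product => //; first exact: fold_coef0_1.
by move=> n; apply: fold_coef0_rec.
Qed.

(** At a square root of -1 the folded coefficients are 2i (-1)^n (2n + 1). They solve the recurrence
    with p = -2, whose characteristic root -1 is double, and the factors 1 - 2 x^n + x^(2n) are the
    squares of those of the Euler product. *)
Lemma jacobi_cube (i r : Cpx) : i ^+ 2 = -1 -> `|i| = 1 -> `|r| < 1 -> r != 0 ->
  gsum 1 1 i r = 2 * i * r * qpoch_inf (r ^+ 8) ^+ 3.
Proof.
move=> i2 i1 r1 r0; have i0 := Cnorm_eq1_neq0 i1.
have iV : i^-1 = - i by apply: (mulfI i0); rewrite divff // mulrN -expr2 i2 opprK.
have G n : fold_coef 1 i n = (2 * n%:R + 1) * (2 * i) * (-1) ^+ n.
  have iN : i ^- (2 * n + 1) = - i ^+ (2 * n + 1).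
    by rewrite -exprVn iV exprNn -signr_odd oddD mul2n odd_double expr1 mulN1r.
  by rewrite /fold_coef iN !expr1 natrD natrM exprD exprM i2 expr1; ring.
have r8 := pow_lt1 r1 (isT : (0 < 8)%N); set x := r ^+ 8 in r8 *.
have [_ Pcv] := poch_cv r8.
have := gsum1_product (p := -2) (isT : (1 <= 1)%N) i1 r1 r0.
rewrite !G => /(_ _ _)/Ccv_unique; apply.
- by rewrite expr0 expr1; ring.
- by move=> n; rewrite !G !exprS -!natr1; ring.
rewrite -/x; have := CcvZ (2 * i * r) (CcvM Pcv (CcvM Pcv Pcv)).
rewrite (_ : _ * (_ * (_ * _)) = 2 * i * r * qpoch_inf x ^+ 3); last by ring.
apply: Ccv_ext => N.
have -> : \prod_(n < N) (1 + -2 * x ^+ n.+1 + x ^+ (2 * n.+1)) = poch x N * poch x N.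
  by rewrite /poch -big_split; apply: eq_bigr => k _ /=; rewrite mulnC exprM; ring.
by rewrite expr0; ring.
Qed.

(** Here p = 2 and the factors are (1 + x^n)^2: Gauss's product for the series over triangular
    numbers. *)
Lemma gauss_triangular (r : Cpx) : `|r| < 1 -> r != 0 ->
  gsum 1 0 1 r = 2 * r * (qpoch_inf (r ^+ 16) ^+ 2 / qpoch_inf (r ^+ 8)).
Proof.
move=> r1 r0.
have r8 := pow_lt1 r1 (isT : (0 < 8)%N); have r16 := pow_lt1 r1 (isT : (0 < 16)%N).
have E : r ^+ 16 = (r ^+ 8) ^+ 2 by rewrite -exprM.
rewrite E in r16 *; set x := r ^+ 8 in r8 r16 *.
have [P0 Pcv] := poch_cv r8; have [Q0 Qcv] := poch_cv r16.
have := gsum1_product0 Cnorm1 r1 r0 => /Ccv_unique; apply.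
rewrite -/x; have := CcvZ (2 * r) (CcvM (CcvM Qcv Qcv) (CcvV P0 Pcv)).
rewrite -expr2; apply: Ccv_ext => N.
have -> : \prod_(n < N) (1 + (1 ^+ 2 + 1 ^- 2) * x ^+ n.+1 + x ^+ (2 * n.+1)) =
    (poch (x ^+ 2) N / poch x N) * (poch (x ^+ 2) N / poch x N).
  rewrite -prod_one_add_exp // -big_split; apply: eq_bigr => k _ /=.
  by rewrite expr1n invr1 mulnC exprM; ring.
by rewrite invr1; field; apply: poch_neq0.
Qed.

(** At w^4 = -1 the middle coefficient w^2 + w^-2 vanishes and the factors reduce to 1 + x^(2n). *)
Lemma gsum_eighth_root (w r : Cpx) : w ^+ 4 = -1 -> `|w| = 1 -> `|r| < 1 -> r != 0 ->
  gsum 1 0 w r =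
  (w + w^-1) * r * (qpoch_inf (r ^+ 8) * qpoch_inf (r ^+ 32) / qpoch_inf (r ^+ 16)).
Proof.
move=> w4 w1 r1 r0; have w0 := Cnorm_eq1_neq0 w1.
have r8 := pow_lt1 r1 (isT : (0 < 8)%N); have r16 := pow_lt1 r1 (isT : (0 < 16)%N).
have r32 := pow_lt1 r1 (isT : (0 < 32)%N).
have E : r ^+ 16 = (r ^+ 8) ^+ 2 by rewrite -exprM.
have E2 : r ^+ 32 = ((r ^+ 8) ^+ 2) ^+ 2 by rewrite -!exprM.
rewrite E2 in r32 *; rewrite E in r16 *; set x := r ^+ 8 in r8 r16 r32 *.
have [P0 Pcv] := poch_cv r8; have [Q0 Qcv] := poch_cv r16; have [S0 Scv] := poch_cv r32.
have := gsum1_product0 w1 r1 r0 => /Ccv_unique; apply.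
rewrite -/x; have := CcvZ ((w + w^-1) * r) (CcvM (CcvM Pcv Scv) (CcvV Q0 Qcv)).
apply: Ccv_ext => N.
have wE : w ^+ 2 + w ^- 2 = 0.
  have w20 : w ^+ 2 != 0 by rewrite expf_neq0.
  by apply: (mulfI w20); rewrite mulrDr divff // -exprD w4 mulr0 addNr.
have -> : \prod_(n < N) (1 + (w ^+ 2 + w ^- 2) * x ^+ n.+1 + x ^+ (2 * n.+1)) =
    poch ((x ^+ 2) ^+ 2) N / poch (x ^+ 2) N.
  rewrite -prod_one_add_exp //; apply: eq_bigr => k _ /=.
  by rewrite wE mul0r addr0 exprM.
by field; rewrite w0 poch_neq0.
Qed.

(** The middle coefficients at z and z^3 are p and -p with p^2 = 2, so paired factors give (1 +
    y^2)^2 - 2 y^2 = 1 + y^4. *)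
Lemma gsum_pair_product (z r : Cpx) : z ^+ 8 = -1 -> `|z| = 1 -> `|r| < 1 -> r != 0 ->
  gsum 1 0 z r * gsum 1 0 (z ^+ 3) r =
  (z ^+ 2 + z ^- 2) * r ^+ 2 *
    (qpoch_inf (r ^+ 8) ^+ 2 * qpoch_inf (r ^+ 64) / qpoch_inf (r ^+ 32)).
Proof.
move=> z8 z1 r1 r0; have z0 := Cnorm_eq1_neq0 z1.
have z31 : `|z ^+ 3| = 1 by rewrite CnormX z1 expr1n.
have r8 := pow_lt1 r1 (isT : (0 < 8)%N); have r32 := pow_lt1 r1 (isT : (0 < 32)%N).
have r64 := pow_lt1 r1 (isT : (0 < 64)%N).
have E : r ^+ 32 = (r ^+ 8) ^+ 4 by rewrite -exprM.
have E2 : r ^+ 64 = ((r ^+ 8) ^+ 4) ^+ 2 by rewrite -!exprM.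
rewrite E2 in r64 *; rewrite E in r32 *; set x := r ^+ 8 in r8 r32 r64 *.
have [P0 Pcv] := poch_cv r8; have [Q0 Qcv] := poch_cv r32; have [S0 Scv] := poch_cv r64.
have := CcvM (gsum1_product0 z1 r1 r0) (gsum1_product0 z31 r1 r0) => /Ccv_unique; apply.
rewrite -/x.
have := CcvZ ((z ^+ 2 + z ^- 2) * r ^+ 2) (CcvM (CcvM (CcvM Pcv Pcv) Scv) (CcvV Q0 Qcv)).
rewrite -expr2; apply: Ccv_ext => N.
have z20 : z ^+ 2 != 0 by rewrite expf_neq0.
have z60 : z ^+ 6 != 0 by rewrite expf_neq0.
have z6 : z ^+ 6 = - z ^- 2 by apply: (mulfI z20); rewrite -exprD z8 mulrN divff.
have z6V : z ^- 6 = - z ^+ 2 by rewrite z6 invrN invrK.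
have z4V : z ^- 4 = - z ^+ 4.
  have z40 : z ^+ 4 != 0 by rewrite expf_neq0.
  by apply: (mulfI z40); rewrite divff // mulrN -exprD z8 opprK.
have p2 : (z ^+ 2 + z ^- 2) ^+ 2 = 2.
  have -> : (z ^+ 2 + z ^- 2) ^+ 2 = z ^+ 4 + z ^- 4 + 2 by field.
  by rewrite z4V subrr add0r.
have c : (z + z^-1) * (z ^+ 3 + (z ^+ 3)^-1) = z ^+ 2 + z ^- 2.
  have -> : (z + z^-1) * (z ^+ 3 + (z ^+ 3)^-1) = z ^+ 4 + z ^- 4 + (z ^+ 2 + z ^- 2) by field.
  by rewrite z4V subrr add0r.
have -> : (z ^+ 3) ^+ 2 + (z ^+ 3) ^- 2 = - (z ^+ 2 + z ^- 2).
  by rewrite -exprM z6V z6 -opprD addrC.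
set p := z ^+ 2 + z ^- 2 in p2 c *.
have prodE : (\prod_(n < N) (1 + p * x ^+ n.+1 + x ^+ (2 * n.+1))) *
   (\prod_(n < N) (1 + - p * x ^+ n.+1 + x ^+ (2 * n.+1))) =
   poch ((x ^+ 4) ^+ 2) N / poch (x ^+ 4) N.
  rewrite -prod_one_add_exp // -big_split; apply: eq_bigr => k _ /=.
  rewrite (_ : (x ^+ 4) ^+ k.+1 = (x ^+ k.+1) ^+ 4); last by rewrite exprAC.
  rewrite (mulnC 2) exprM; move: (x ^+ k.+1) => y.
  have -> : (1 + p * y + y ^+ 2) * (1 + - p * y + y ^+ 2) =
     1 + 2 * y ^+ 2 + y ^+ 4 - p ^+ 2 * y ^+ 2 by ring.
  by rewrite p2; ring.
rewrite -(mulrA (poch x N * poch x N)) -prodE -c; ring.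
Qed.

Lemma gsum_wronskian_product (z r : Cpx) : z ^+ 8 = -1 -> `|z| = 1 -> `|r| < 1 -> r != 0 ->
  gsum 1 2 z r * gsum 1 0 (z ^+ 3) r - gsum 1 0 z r * gsum 1 2 (z ^+ 3) r =
  32 * r ^+ 10 * qpoch_inf (r ^+ 16) ^+ 3 * qpoch_inf (r ^+ 64) ^+ 3.
Proof.
move=> z8 z1 r1 r0; have z0 := Cnorm_eq1_neq0 z1.
have n1 k : `|z ^+ k| = 1 by rewrite CnormX z1 expr1n.
have rk k : (0 < k)%N -> `|r ^+ k| < 1 by apply: pow_lt1.
have i2 : (z ^+ 4) ^+ 2 = -1 by rewrite -exprM.
have iV : (z ^+ 4)^-1 = - z ^+ 4.
  have z40 : z ^+ 4 != 0 by rewrite expf_neq0.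
  by apply: (mulfI z40); rewrite divff // mulrN -expr2 i2 opprK.
(* On even indices the sign change of the parameter has no effect while inversion gives (-1)^k; at
   z^4 the two coincide, so for odd [k] the sum equals its opposite. *)
have zero k s : `|s| < 1 -> odd k -> (k <= 2)%N -> gsum 0 k (z ^+ 4) s = 0.
  move=> s1 ok k2; have := gsumV 0 k2 (n1 4) s1.
  rewrite iV (gsumN 0 k2 (n1 4) s1) expr0z mul1r -signr_odd ok expr1 mulN1r.
  exact: eq_opp_eq0.
apply: etrans (gsum_wronskian z1 (n1 3) r1 r0) _.
have -> : z * z ^+ 3 = z ^+ 4 by rewrite -exprS.
have -> : z / z ^+ 3 = (z ^+ 2)^-1 by field.
rewrite (zero 1%N _ (rk 2 isT)) // mul0r addr0.
rewrite (gsumV 0 (isT : (1 <= 2)%N) (n1 2) (rk 2 isT)).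
(* The even-index factor at z^2 becomes a sum over all integers at z^4; its even part vanishes again
   and the odd part is a second instance of Jacobi's identity. *)
rewrite (gsum0_split (isT : (1 <= 2)%N) (n1 2) (rk 2 isT)) -!exprM.
rewrite (zero 1%N _ (rk 8 isT)) // add0r.
rewrite (jacobi_cube i2 (n1 4) (rk 2 isT)) ?expf_neq0 //.
rewrite (jacobi_cube i2 (n1 4) (rk 8 isT)) ?expf_neq0 // -!exprM /=.
rewrite !expr1; set a := qpoch_inf _; set b := qpoch_inf _.
transitivity (- (z ^+ 4) ^+ 2 * (32 * r ^+ 10 * a ^+ 3 * b ^+ 3)); first by ring.
by rewrite i2 opprK mul1r.
Qed.

(** In the notation of the proof a^2 - b^2 = 2 X F and a b = I X, with F = T + U and I = T - U, so
    the quartic is 4 X^2 (F^2 - I^2) = 16 X^2 T U = 8 X^2 V^2. [Y] and [H] cancel, and only [X] and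
    [V] require a product formula. *)
Lemma gsum_quartic_product (z r : Cpx) : z ^+ 8 = -1 -> `|z| = 1 -> `|r| < 1 -> r != 0 ->
  let a := gsum 1 0 z r in let b := gsum 1 0 (z ^+ 3) r in
  a ^+ 4 - 6 * a ^+ 2 * b ^+ 2 + b ^+ 4 =
  64 * r ^+ 12 * (qpoch_inf (r ^+ 16) ^+ 2 * qpoch_inf (r ^+ 64) ^+ 6 / qpoch_inf (r ^+ 32) ^+ 4).
Proof.
move=> z8 z1 r1 r0 a b; have z0 := Cnorm_eq1_neq0 z1.
have n1 k : `|z ^+ k| = 1 by rewrite CnormX z1 expr1n.
have rk k : (0 < k)%N -> `|r ^+ k| < 1 by apply: pow_lt1.
have z2 : (0 <= 2)%N by [].
have i2 : (z ^+ 4) ^+ 2 = -1 by rewrite -exprM.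
have iV : (z ^+ 4)^-1 = - z ^+ 4.
  have z40 : z ^+ 4 != 0 by rewrite expf_neq0.
  by apply: (mulfI z40); rewrite divff // mulrN -expr2 i2 opprK.
have z6 : z ^+ 6 = - (z ^+ 2)^-1.
  have z20 : z ^+ 2 != 0 by rewrite expf_neq0.
  by apply: (mulfI z20); rewrite -exprD z8 mulrN divff.
have zero s : `|s| < 1 -> gsum 1 0 (z ^+ 4) s = 0.
  move=> s1; have := gsumV 1 z2 (n1 4) s1.
  rewrite iV (gsumN 1 z2 (n1 4) s1) expr1z expr0 mul1r mulN1r.
  by move=> /esym; apply: eq_opp_eq0.
pose X := gsum 1 0 (z ^+ 2) (r ^+ 2); pose Y := gsum 0 0 (z ^+ 2) (r ^+ 2).
pose F := gsum 0 0 1 (r ^+ 2); pose H := gsum 1 0 1 (r ^+ 2).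
pose I := gsum 0 0 (z ^+ 4) (r ^+ 2).
pose T := gsum 0 0 1 (r ^+ 8); pose U := gsum 1 0 1 (r ^+ 8).
pose V := gsum 1 0 1 (r ^+ 4).
have aa : a * a = X * F + Y * H.
  apply: etrans (gsum_mul00 z1 z1 r1 r0) _.
  by rewrite divff // -expr2.
have bb : b * b = - X * F + Y * H.
  apply: etrans (gsum_mul00 (n1 3) (n1 3) r1 r0) _.
  have -> : z ^+ 3 / z ^+ 3 = 1 by rewrite divff ?expf_neq0.
  (* The minus sign in z^6 = -z^-2 is felt on odd indices only; it reverses the [X] term and leaves
     the [Y] term alone. *)
  have -> : z ^+ 3 * z ^+ 3 = - (z ^+ 2)^-1 by rewrite -exprD z6.
  have m1 : `|(z ^+ 2)^-1| = 1 by rewrite CnormV n1 invr1.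
  rewrite (gsumN 1 z2 m1 (rk 2 isT)) (gsumN 0 z2 m1 (rk 2 isT)).
  rewrite (gsumV 1 z2 (n1 2) (rk 2 isT)) (gsumV 0 z2 (n1 2) (rk 2 isT)).
  by rewrite expr1z expr0z !expr0 !mul1r mulN1r.
have ab : a * b = I * X.
  apply: etrans (gsum_mul00 z1 (n1 3) r1 r0) _.
  have -> : z * z ^+ 3 = z ^+ 4 by rewrite -exprS.
  have -> : z / z ^+ 3 = (z ^+ 2)^-1 by field.
  rewrite (zero _ (rk 2 isT)) mul0r add0r.
  by rewrite (gsumV 1 z2 (n1 2) (rk 2 isT)) expr0 mul1r.
have FE : F = T + U.
  have := gsum0_split z2 Cnorm1 (rk 2 isT); rewrite expr0 mul1r expr1n -exprM; exact.
have IE : I = T - U.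
  have := gsum0_split z2 (n1 4) (rk 2 isT); rewrite expr0 mul1r i2 -exprM -/I => ->.
  rewrite (gsumN 1 z2 Cnorm1 (rk 8 isT)) (gsumN 0 z2 Cnorm1 (rk 8 isT)).
  by rewrite expr1z expr0z !mul1r mulN1r.
have VV : V * V = U * T + T * U.
  apply: etrans (gsum_mul00 Cnorm1 Cnorm1 (rk 4 isT) _) _; first by rewrite expf_neq0.
  have E8 : (r ^+ 4) ^+ 2 = r ^+ 8 by rewrite -exprM.
  rewrite E8.
  rewrite (divff (oner_neq0 Cpx)).
  rewrite (mulr1 1).
  exact: erefl.
have w4 : (z ^+ 2) ^+ 4 = -1 by rewrite -exprM.
have XE := gsum_eighth_root w4 (n1 2) (rk 2 isT) (expf_neq0 2 r0).
have VE := gauss_triangular (rk 4 isT) (expf_neq0 4 r0).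
rewrite -/X -!exprM /= in XE; rewrite -/V -!exprM /= in VE.
clearbody a b X Y F H I T U V.
have -> : a ^+ 4 - 6 * a ^+ 2 * b ^+ 2 + b ^+ 4 = (a * a - b * b) ^+ 2 - 4 * (a * b) ^+ 2 by ring.
rewrite aa bb ab FE IE.
have -> : (X * (T + U) + Y * H - (- X * (T + U) + Y * H)) ^+ 2 - 4 * ((T - U) * X) ^+ 2 =
   8 * X ^+ 2 * (U * T + T * U) by ring.
rewrite -VV XE VE.
have p2 : (z ^+ 2 + (z ^+ 2)^-1) ^+ 2 = 2.
  have -> : (z ^+ 2 + (z ^+ 2)^-1) ^+ 2 = z ^+ 4 + (z ^+ 4)^-1 + 2 by field.
  by rewrite iV subrr add0r.
have [A0 _] := poch_cv (rk 32 isT).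
rewrite [in LHS]exprMn exprMn p2; field; exact: A0.
Qed.

(** * The Riccati equation *)

Lemma RtoCD : {morph RtoC : x y / x + y}.
Proof. by move=> x y; apply: Cpx_eq; rewrite //= !RE addr0. Qed.

Lemma RtoCM : {morph RtoC : x y / x * y}.
Proof. by move=> x y; apply: Cpx_eq; rewrite /= !RE; ring. Qed.

Lemma RtoCN : {morph RtoC : x / - x}.
Proof. by move=> x; apply: Cpx_eq; rewrite /= !RE ?oppr0. Qed.

Lemma RtoC_nat n : RtoC n%:R = n%:R.
Proof. by elim: n => [//|n IH]; rewrite -!natr1 RtoCD IH. Qed.

Lemma RtoC_neq0 (x : R) : x != 0 -> RtoC x != 0.
Proof. by move=> x0; apply/eqP => -[] /eqP; rewrite (negbTE x0). Qed.

Lemma RtoCV : {morph RtoC : x / x^-1}.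
Proof.
move=> x; have [->|x0] := eqVneq x 0; first by rewrite !invr0.
apply: (mulfI (RtoC_neq0 x0)).
by rewrite -RtoCM (divff x0) (divff (RtoC_neq0 x0)).
Qed.

Lemma IZR_nat n : IZR (Z.of_nat n) = n%:R.
Proof. by rewrite -INR_IZR_INZ INRE. Qed.

Lemma RtoC_IZR_nat n : RtoC (IZR (Z.of_nat n)) = n%:R.
Proof. by rewrite IZR_nat RtoC_nat. Qed.

Lemma Cpx_natr_neq0 n : n.+1%:R != 0 :> Cpx.
Proof. by rewrite -normr_eq0 Cnorm_nat pnatr_eq0. Qed.

(** * The constant 2 pi i, the nome and the root of unity *)

Definition tpi := Cmul (RtoC 2) (Cmul (RtoC PI) Ci).
Definition nome8 (tau : Cpx) := Cexp (tpi / 8 * tau).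
Definition zeta16 := Cexp (tpi / 16).

Lemma Re_tpi : Re tpi = 0.
Proof. by rewrite /= !RE; ring. Qed.

Lemma Im_tpi : Im tpi = 2 * PI.
Proof. by rewrite /= !RE (IZR_nat 2); ring. Qed.

Lemma Re_mul z w : Re (z * w) = Re z * Re w - Im z * Im w.
Proof. by []. Qed.

Lemma Im_mul z w : Im (z * w) = Re z * Im w + Im z * Re w.
Proof. by []. Qed.

Lemma Re_scale z (x : R) : Re (z * RtoC x) = Re z * x.
Proof. by rewrite Re_mul /= !RE mulr0 subr0. Qed.

Lemma Im_scale z (x : R) : Im (z * RtoC x) = Im z * x.
Proof. by rewrite Im_mul /= !RE mulr0 add0r. Qed.

Lemma Re_tpi_scale (x : R) : Re (tpi * RtoC x) = 0.
Proof. by rewrite Re_scale Re_tpi mul0r. Qed.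

Lemma Im_tpi_scale (x : R) : Im (tpi * RtoC x) = 2 * PI * x.
Proof. by rewrite Im_scale Im_tpi. Qed.

Lemma tpi_div n : tpi / n%:R = tpi * RtoC n%:R^-1.
Proof. by rewrite RtoCV RtoC_nat. Qed.

Lemma zeta16_pow n : zeta16 ^+ n = Cexp (tpi * RtoC (n%:R / 16%:R)).
Proof. by rewrite -CexpMn tpi_div RdivE RtoCM -mulrA RtoC_nat (mulrC _ n%:R). Qed.

Lemma zeta16_exp8 : zeta16 ^+ 8 = -1.
Proof.
rewrite zeta16_pow; have := Re_tpi_scale (8%:R / 16%:R); have := Im_tpi_scale (8%:R / 16%:R).
have -> : 2 * PI * Rdiv 8%:R 16%:R = PI by rewrite RdivE; field.
move=> hi hr; apply: Cpx_eq; rewrite /Cexp hr hi /=; first by rewrite exp_0 cos_PI !RE mul1r.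
by rewrite sin_PI !RE mulr0 oppr0.
Qed.

Lemma norm_zeta16 : `|zeta16| = 1.
Proof. by rewrite norm_Cexp tpi_div Re_tpi_scale exp_0. Qed.

Lemma sqrt2_sqr : (sqrt 2 : R) ^+ 2 = 2.
Proof.
have h : Rle (IZR 0) (IZR 2) by apply/RleP; rewrite (IZR_nat 2); apply: (ler0n _ 2).
by rewrite expr2; have := sqrt_sqrt (IZR 2) h; rewrite RmultE => ->; apply: (IZR_nat 2).
Qed.

Lemma sqrt2_neq0 : sqrt 2 != 0 :> R.
Proof. by rewrite -sqrf_eq0 sqrt2_sqr pnatr_eq0. Qed.

(** The value is 2 cos(pi/4), the source of the square root of two in the equation. *)
Lemma zeta16_sqr : zeta16 ^+ 2 + zeta16 ^- 2 = RtoC (sqrt 2).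
Proof.
rewrite zeta16_pow -CexpN; have := Re_tpi_scale (2%:R / 16%:R); have := Im_tpi_scale (2%:R / 16%:R).
have -> : 2 * PI * Rdiv 2%:R 16%:R = Rdiv PI (IZR 4) by rewrite !RdivE (IZR_nat 4); field.
move: (tpi * _) => w hi hr; rewrite /Cexp [Re (- w)]/= [Im (- w)]/= hr hi.
apply: Cpx_eq; rewrite /= ?cos_neg ?sin_neg !RE oppr0 exp_0.
  rewrite cos_PI4 !RE RdivE mul1r; have s0 := sqrt2_neq0.
  by apply: (mulIf s0); rewrite mulrDl divfK // -expr2 sqrt2_sqr.
by rewrite !RE; ring.
Qed.

Lemma norm_nome8_lt1 tau : 0 < Im tau -> `|nome8 tau| < 1.
Proof.
move=> t0; rewrite norm_Cexp tpi_div Re_mul Re_tpi_scale Im_tpi_scale mul0r sub0r.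
suff : exp (- (2 * PI * 8%:R^-1 * Im tau)) < exp 0 by rewrite exp_0.
have p0 : 0 < PI by apply/RltP; apply: PI_RGT_0.
apply/RltP/exp_increasing/RltP; rewrite oppr_lt0; move: PI p0 => p p0.
have i0 : 0 < 8%:R^-1 :> R by rewrite invr_gt0 ltr0n.
by rewrite !RE (IZR_nat 2); apply: mulr_gt0 => //; apply: mulr_gt0 => //; apply: mulr_gt0.
Qed.

Lemma nome8_exp8 tau : nome8 tau ^+ 8 = qof tau.
Proof.
rewrite -CexpMn /qof -/tpi; congr Cexp.
by change (Cmul tpi tau) with (tpi * tau); field; apply: Cpx_natr_neq0.
Qed.

(** Writing m + 1/2 as (2m + 1)/2 turns the exponent into (2m + 1)^2 tau / 8 + (2m + 1) k / 16,
    hence the eighth root of q and the sixteenth root of unity. *)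
Lemma theta_term (k : nat) (e' : R) (tau : Cpx) (z : Z) (m : int) :
  RtoC e' = k%:R / 4 -> RtoC (IZR z) = m%:~R ->
  (let a := RtoC (Rplus (IZR z) (Rdiv 1 2)) in
   Cexp (Cmul (Cmul (RtoC 2) (Cmul (RtoC PI) Ci))
      (Cadd (Cmul (RtoC (Rdiv 1 2)) (Cmul (Cmul a a) tau))
            (Cmul a (Cadd (RtoC 0) (RtoC (Rdiv e' 2))))))) =
  gterm 0 (zeta16 ^+ k) (nome8 tau) (2 * m + 1).
Proof.
move=> he hz; rewrite /gterm expr0 mul1r exprnP exprz_exp /nome8 /zeta16.
rewrite -!CexpMz -CexpD -/tpi; move: tpi => w; congr Cexp.
have h2 : RtoC (IZR 2) = 2 := RtoC_IZR_nat 2.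
rewrite !RdivE RplusE RtoCD !RtoCM RtoCV h2 hz he.
rewrite rmorphXn /= !intrM !intrD !intrM -!pmulrn.
change (RtoC 1) with (1 : Cpx); change (RtoC 0) with (0 : Cpx).
change Cmul with (@GRing.mul Cpx); change Cadd with (@GRing.add Cpx).
move: (m%:~R) => M; field.
by rewrite (Cpx_natr_neq0 7) (Cpx_natr_neq0 15) (Cpx_natr_neq0 1) (Cpx_natr_neq0 3).
Qed.

Lemma theta_gsum (k : nat) (e' : R) (tau : Cpx) : RtoC e' = k%:R / 4 -> 0 < Im tau ->
  theta 1 e' (RtoC 0) tau = gsum 1 0 (zeta16 ^+ k) (nome8 tau).
Proof.
move=> he t0; apply: Zsum_eq.
- apply: asummable_gterm2 => //; last exact: norm_nome8_lt1.
  by rewrite CnormX norm_zeta16 expr1n.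
- by move=> n; apply: theta_term => //; rewrite RtoC_IZR_nat.
by move=> n; apply: theta_term => //; rewrite opp_IZR RoppE RtoCN RtoC_IZR_nat NegzE mulrNz.
Qed.

Lemma Wfun_gsum (tau : Cpx) : 0 < Im tau ->
  Wfun tau = gsum 1 0 zeta16 (nome8 tau) * (gsum 1 0 (zeta16 ^+ 3) (nome8 tau))^-1 *
    (gsum 1 0 zeta16 (nome8 tau) * (gsum 1 0 (zeta16 ^+ 3) (nome8 tau))^-1).
Proof.
move=> t0; rewrite /Wfun.
have h4 : RtoC (IZR 4) = 4 := RtoC_IZR_nat 4.
have h3 : RtoC (IZR 3) = 3 := RtoC_IZR_nat 3.
rewrite (@theta_gsum 1 (Rdiv 1 4)) //; last by rewrite RdivE RtoCM RtoCV h4.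
rewrite (@theta_gsum 3 (Rdiv 3 4)) //; last by rewrite RdivE RtoCM RtoCV h4 h3.
rewrite expr1; move: (gsum _ _ _ _) (gsum _ _ _ _) => b a.
change (a * a / (b * b) = a * b^-1 * (a * b^-1)).
by rewrite invfM; ring.
Qed.

(** Over t3^4, the derivative is t1 t3 times the Wronskian and W^2 - 6W + 1 is the quartic form, so
    the three product evaluations turn the equation into an identity of monomials. *)
Lemma riccati_algebra (s r t1 t3 D1 D3 P1 P2 P4 P8 : Cpx) :
  s ^+ 2 = 2 -> r != 0 -> t3 != 0 -> P4 != 0 -> P8 != 0 ->
  t1 * t3 = s * r ^+ 2 * (P1 ^+ 2 * P8 / P4) ->
  D1 * t3 - t1 * D3 = 32 * r ^+ 10 * P2 ^+ 3 * P8 ^+ 3 ->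
  t1 ^+ 4 - 6 * t1 ^+ 2 * t3 ^+ 2 + t3 ^+ 4 =
    64 * r ^+ 12 * (P2 ^+ 2 * P8 ^+ 6 / P4 ^+ 4) ->
  let W := t1 * t3^-1 * (t1 * t3^-1) in
  2 * (t1 * t3^-1) * (D1 * t3^-1 + t1 * (- t3^-1 ^+ 2 * D3)) / 8 =
  (4 * s)^-1 * (P1 ^+ 2 * P2 * P4 ^+ 3 / P8 ^+ 2 * (W * W - 6 * W + 1)).
Proof.
move=> s2 r0 t30 P40 P80 Ht HD HQ W.
have n2 : 2 != 0 :> Cpx := Cpx_natr_neq0 1.
have n4 : 4 != 0 :> Cpx := Cpx_natr_neq0 3.
have n8 : 8 != 0 :> Cpx := Cpx_natr_neq0 7.
have s0 : s != 0 by rewrite -sqrf_eq0 s2.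
transitivity (t1 * t3 * (D1 * t3 - t1 * D3) / (4 * t3 ^+ 4)).
  by field; rewrite ?n2 ?n4 ?n8 ?t30.
transitivity ((4 * s)^-1 * (P1 ^+ 2 * P2 * P4 ^+ 3 / P8 ^+ 2) *
   (t1 ^+ 4 - 6 * t1 ^+ 2 * t3 ^+ 2 + t3 ^+ 4) / t3 ^+ 4); last first.
  by rewrite /W; field; rewrite ?n2 ?n4 ?n8 ?t30 ?s0 ?P80.
rewrite Ht HD HQ.
(* Since s^2 = 2; this puts on the right the same factor [s] that [Ht] brings to the left. *)
have -> : (4 * s)^-1 = s / 8.
  by apply: (mulIf s0); rewrite mulrAC -expr2 s2; field; rewrite ?n2 ?n4 ?n8 ?s0.
by field; rewrite ?n2 ?n4 ?n8 ?t30 ?P40 ?P80.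
Qed.

(** The inner derivative of [nome8] is r times 2 pi i / 8; its [r] cancels the division by r in
    [isD_gsum1], and the division by 8 remains. *)
Lemma isD_Wfun (tau : Cpx) : 0 < Im tau ->
  let r := nome8 tau in
  let t1 := gsum 1 0 zeta16 r in let t3 := gsum 1 0 (zeta16 ^+ 3) r in
  let D1 := gsum 1 2 zeta16 r in let D3 := gsum 1 2 (zeta16 ^+ 3) r in
  t3 != 0 ->
  isD Wfun tau (tpi * (2 * (t1 * t3^-1) * (D1 * t3^-1 + t1 * (- t3^-1 ^+ 2 * D3)) / 8)).
Proof.
move=> t0 r t1 t3 D1 D3 t30.
have r1 : `|r| < 1 := norm_nome8_lt1 t0.
have r0 : r != 0 := Cexp_neq0 _.
have z31 : `|zeta16 ^+ 3| = 1 by rewrite CnormX norm_zeta16 expr1n.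
have dr := isD_Cexp (tpi / 8) tau.
have d1 := isD_comp dr (isD_gsum1 norm_zeta16 r1 r0).
have d3 := isD_comp dr (isD_gsum1 z31 r1 r0).
have dq := isD_mul d1 (isD_comp d3 (isD_inv t30)).
have := isD_mul dq dq; rewrite -/(nome8 tau) -/r -/t1 -/t3 -/D1 -/D3.
set l := (X in isD _ _ X) => dW.
have -> : tpi * (2 * (t1 * t3^-1) * (D1 * t3^-1 + t1 * (- t3^-1 ^+ 2 * D3)) / 8) = l.
  rewrite /l; clearbody t1 t3 D1 D3 r.
  by field; rewrite t30 r0 (Cpx_natr_neq0 7).
(* The expression of [Wfun] by theta series is available in the upper half-plane only; |h| < Im tau
   keeps tau + h inside. *)
apply: isD_near t0 _ dW => h hI; rewrite Wfun_gsum //=.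
by rewrite RplusE; have := Cnorm_Im h; have := ler_norm (- Im h); rewrite normrN; lra.
Qed.

Lemma riccati (tau : Cpx) : 0 < Im tau ->
  let P n := qpoch_inf (qof tau ^+ n) in
  exists2 dW, isD Wfun tau dW & dW / tpi = (4 * RtoC (sqrt 2))^-1 *
    (P 1%N ^+ 2 * P 2 * P 4 ^+ 3 / P 8 ^+ 2 * (Wfun tau * Wfun tau - 6 * Wfun tau + 1)).
Proof.
move=> t0 P; have r1 := norm_nome8_lt1 t0.
have r0 : nome8 tau != 0 := Cexp_neq0 _.
have PE n : P n = qpoch_inf (nome8 tau ^+ (8 * n)) by rewrite /P -nome8_exp8 exprM.
have P0 n : (0 < n)%N -> P n != 0.
  move=> n0; rewrite PE; have h : `|nome8 tau ^+ (8 * n)| < 1 by apply: pow_lt1 => //; lia.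
  by case: (poch_cv h).
have s2 : RtoC (sqrt 2) ^+ 2 = 2 by rewrite expr2 -RtoCM -expr2 sqrt2_sqr RtoC_nat.
have s0 : RtoC (sqrt 2) != 0 by rewrite RtoC_neq0 // sqrt2_neq0.
have Ht := gsum_pair_product zeta16_exp8 norm_zeta16 r1 r0.
have HD := gsum_wronskian_product zeta16_exp8 norm_zeta16 r1 r0.
have HQ := gsum_quartic_product zeta16_exp8 norm_zeta16 r1 r0.
rewrite zeta16_sqr -(PE 1%N) -(PE 8) -(PE 4) in Ht.
rewrite -(PE 2) -(PE 8) in HD; rewrite -(PE 2) -(PE 8) -(PE 4) in HQ.
(* A zero of t3 would annihilate t1 t3, whose product evaluation is not zero. *)
have t30 : gsum 1 0 (zeta16 ^+ 3) (nome8 tau) != 0.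
  apply: contra_eq_neq Ht => ->; rewrite mulr0 eq_sym.
  by rewrite !mulf_neq0 // ?invr_neq0 ?expf_neq0 ?P0.
eexists; first exact: isD_Wfun t0 t30.
rewrite Wfun_gsum // -(riccati_algebra s2 r0 t30 (P0 4 isT) (P0 8 isT) Ht HD HQ).
have p0 : tpi != 0.
  apply/eqP => h; have := Im_tpi; rewrite h => /esym/eqP; rewrite mulf_eq0 pnatr_eq0 /= => /eqP h0.
  by have := PI_RGT_0; rewrite h0 => /RltP; rewrite ltxx.
by rewrite mulrC mulKf.
Qed.

Lemma inv_sqrt2_pow5 : RtoC (Rdiv 1 (pow (sqrt 2) 5)) = (4 * RtoC (sqrt 2))^-1.
Proof.
rewrite RdivE RtoCM RtoCV RpowE.
have -> : sqrt 2 ^+ 5 = 4%:R * sqrt 2 :> R.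
  by rewrite exprS (exprM _ 2 2) sqrt2_sqr mulrC; congr (_ * _); ring.
by rewrite RtoCM RtoC_nat; apply: mul1r.
Qed.

Open Scope R_scope.

(* q dW/dq = (1/(2 pi i)) dW/dtau *)
Theorem mainTheorem14 (tau : Cpx) (Htau : Im tau > 0) :
  exists dW : Cpx,
    Cderiv_lim Wfun tau dW /\
    Cdiv dW (Cmul (RtoC 2) (Cmul (RtoC PI) Ci)) =
    Cmul (RtoC (1 / (sqrt 2) ^ 5))
      (Cmul
        (Cdiv
          (Cmul (Cmul (Cpow (qpoch_inf (qof tau)) 2) (qpoch_inf (Cpow (qof tau) 2)))
                (Cpow (qpoch_inf (Cpow (qof tau) 4)) 3))
          (Cpow (qpoch_inf (Cpow (qof tau) 8)) 2))
        (Cadd (Csub (Cmul (Wfun tau) (Wfun tau)) (Cmul (RtoC 6) (Wfun tau))) (RtoC 1))).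
Proof.
have [dW isDW dWE] := riccati (introT RltP Htau).
exists dW; split; first exact: isD_Cderiv_lim.
have h6 : RtoC 6 = (6%:R)%R := RtoC_IZR_nat 6.
rewrite inv_sqrt2_pow5 h6 !CpowE; rewrite expr1 in dWE.
exact: dWE.
Qed.
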